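(* Let $(\mathcal X,\rho,\mu)$ be a space of homogeneous type with constants $K_1,K_2$. Let $f,g:\mathcal X\to\mathbb R$ be a pair of measurable functions, $p_0,p\in(1,\infty)$, and $w\in A_p$. Then there exists a constant $\Lambda_0=\Lambda_0(K_1,K_2,p_0,p,[w]_{A_p})\ge1$ such that if (for a constant $N_0$) $$\|f\|_{L_{p_0}(\tilde w\,d\mu)}\le N_0\|g\|_{L_{p_0}(\tilde w\,d\mu)}$$ for every $\tilde w\in A_{p_0}$ satisfying $[\tilde w]_{A_{p_0}}\le\Lambda_0$, then $$\|f\|_{L_p(w\,d\mu)}\le4N_0\|g\|_{L_p(w\,d\mu)}.$$ Moreover, if $[w]_{A_p}\le K_0$, then $\Lambda_0$ can be chosen so that it depends only on $K_1,K_2,p_0,p$, and $K_0$.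
   Context: Space of homogeneous type: $\mathcal X$ is a set with a quasi-metric $\rho$, i.e. a nonnegative symmetric function with $\rho(x,y)=0$ iff $x=y$ and $\rho(x,y)\le K_1(\rho(x,z)+\rho(z,y))$; $B_r(x)=\{y:\rho(x,y)<r\}$; balls are assumed open; $\mu$ is a complete Borel measure on a $\sigma$-algebra containing all balls, with $0<\mu(B_{2r}(x))\le K_2\mu(B_r(x))<\infty$ for all $x\in\mathcal X$, $r>0$; the Lebesgue differentiation theorem is assumed to hold in $(\mathcal X,\mu)$. For $p\in(1,\infty)$, $A_p$ is the set of nonnegative measurable $w$ on $\mathcal X$ with $$[w]_{A_p}=\sup_{x_0\in\mathcal X,r>0}\Big(\frac1{\mu(B_r(x_0))}\int_{B_r(x_0)}w\,d\mu\Big)\Big(\frac1{\mu(B_r(x_0))}\int_{B_r(x_0)}w^{-1/(p-1)}\,d\mu\Big)^{p-1}<\infty$$ (in particular $w>0$ a.e.). $\|f\|_{L_p(w\,d\mu)}^p=\int_{\mathcal X}|f|^pw\,d\mu$ (possibly infinite). *)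

(* Defs.v *)
From HB Require Import structures.
From mathcomp Require Import all_boot all_order all_algebra.
From mathcomp Require Import all_classical all_reals all_analysis.
Set Implicit Arguments.
Unset Strict Implicit.
Unset Printing Implicit Defensive.
Import Order.TTheory GRing.Theory Num.Theory.
Import numFieldNormedType.Exports.
Local Open Scope classical_set_scope.
Local Open Scope ring_scope.
Local Open Scope ereal_scope.

Section quasi_metric.
Context {R : realType} {X : Type}.
Implicit Types rho : X -> X -> R.

Record quasi_metric (K1 : R) rho : Prop := QuasiMetric {
  qm_ge0 : forall x y, (0 <= rho x y)%R ;
  qm_sym : forall x y, rho x y = rho y x ;
  qm_eq0 : forall x y, rho x y = 0%R <-> x = y ;
  qm_triangle : forall x y z, (rho x y <= K1 * (rho x z + rho z y))%R }.

Definition qball rho (x : X) (r : R) : set X := [set y | (rho x y < r)%R].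

Definition qopen rho (U : set X) : Prop :=
  forall x, U x -> exists2 r : R, (0 < r)%R & qball rho x r `<=` U.

End quasi_metric.

Section homogeneous.
Context {R : realType} {d : measure_display} {X : measurableType d}.
Variables (mu : {measure set X -> \bar R}) (rho : X -> X -> R).

Definition avg (A : set X) (f : X -> \bar R) : \bar R :=
  (mu A)^-1 * \int[mu]_(y in A) f y.

Definition loc_integrable (f : X -> R) : Prop :=
  forall x r, (0 < r)%R -> mu.-integrable (qball rho x r) (EFin \o f).

Definition lebesgue_differentiation : Prop :=
  forall f : X -> R, loc_integrable f ->
  {ae mu, forall x, avg (qball rho x r) (EFin \o f) @[r --> 0^'+] --> (f x)%:E}.

(* The sigma-algebra on which mu is defined is the one carried by X; it may be
   strictly larger than the Borel one. *)
Record homogeneous_type (K1 K2 : R) : Prop := HomogeneousType {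
  ht_qm : quasi_metric K1 rho ;
  ht_ball_open : forall x r, qopen rho (qball rho x r) ;
  ht_ball_measurable : forall x r, measurable (qball rho x r) ;
  ht_borel : forall U, qopen rho U -> measurable U ;
  ht_complete : measure_is_complete mu ;
  ht_doubling : forall x r, (0 < r)%R ->
    [/\ 0 < mu (qball rho x (2 * r)%R),
        mu (qball rho x (2 * r)%R) <= K2%:E * mu (qball rho x r) &
        K2%:E * mu (qball rho x r) < +oo] ;
  ht_lebesgue : lebesgue_differentiation }.

(* w^(-1/(p-1)), written as (1/w)^(1/(p-1)) in the extended reals so that it is
   +oo where w vanishes (the real power gives 0 `^ a = 0 for every a != 0). *)
Definition dual_weight (p : R) (w : X -> R) (x : X) : \bar R :=
  ((w x)%:E^-1) `^ (p - 1)^-1%R.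

Definition Ap_const (p : R) (w : X -> R) : \bar R :=
  ereal_sup [set q : \bar R | exists x0 r, (0 < r)%R /\
    q = avg (qball rho x0 r) (EFin \o w) *
        avg (qball rho x0 r) (dual_weight p w) `^ (p - 1)%R].

(* Positivity almost everywhere is required explicitly: since 0 * +oo = 0 in
   \bar R, a weight vanishing on a ball would otherwise contribute 0, rather
   than +oo, to the supremum. *)
Definition Ap_weight (p : R) (w : X -> R) : Prop :=
  [/\ forall x, (0 <= w x)%R, measurable_fun setT w,
      {ae mu, forall x, (0 < w x)%R} & Ap_const p w < +oo].

Definition wnorm (p : R) (w f : X -> R) : \bar R :=
  (\int[mu]_x (`|f x| `^ p * w x)%:E) `^ p^-1%R.

Definition extrapolates (p0 p Lambda0 : R) (w f g : X -> R) : Prop :=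
  forall N0 : R,
  (forall w0 : X -> R, Ap_weight p0 w0 -> Ap_const p0 w0 <= Lambda0%:E ->
     wnorm p0 w0 f <= N0%:E * wnorm p0 w0 g) ->
  wnorm p w f <= (4 * N0)%:E * wnorm p w g.

End homogeneous.

(* Main.v *)
Require Import Defs.
From HB Require Import structures.
From mathcomp Require Import all_boot all_order all_algebra.
From mathcomp Require Import all_classical all_reals all_analysis.
From mathcomp Require Import measurable_realfun.
From mathcomp Require Import ring lra.
Set Implicit Arguments.
Unset Strict Implicit.
Unset Printing Implicit Defensive.
Import Order.TTheory GRing.Theory Num.Theory.
Import numFieldNormedType.Exports.
Local Open Scope classical_set_scope.
Local Open Scope ring_scope.

(** Rubio de Francia's algorithm.  For [w] in [A_p] the maximal operator [M] is
    bounded on [L^p(w)], with norm [C] controlled by the constants of the space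
    and by [[w]_{A_p}], and likewise on [L^p'(s)] for the dual weight
    [s = w^(-1/(p-1))].  Every [h] in [L^p(w)] then has a majorant [H] with
    [M H <= 2 C H], an [A_1] condition, and norm at most [2 ||h||].
    Take such majorants [H] of [|g|] in [L^p(w)] and [V] of [u^(p-1) w] in
    [L^p'(s)], where [u <= |f|] is bounded and supported in a ball.  The weight
    [H^(1-p0) V] lies in [A_{p0}] with a controlled constant, so Hoelder's
    inequality, applied twice, and the hypothesis give
    [int u^p w <= int |f| V <= N0 int H V <= 4 N0 ||g|| (int u^p w)^(1/p')].

    The bound on [M] is Lerner's: with [M_w], [M_s] the maximal operators of the
    measures [w dmu], [s dmu], which are doubling by Hoelder's inequality,
    [(M f)^(p-1) <= [w]_{A_p} M_w((M_s (f/s))^(p-1) / w)] pointwise, and the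
    maximal operator of a doubling measure is bounded on every [L^q], [q > 1],
    by the Vitali covering lemma and Marcinkiewicz interpolation. *)

(** * Vitali covering lemma *)

(** [Lambda0] must be fixed before the space, the measure and the functions, so every operator norm
    is an explicit expression in the quasi-metric constant, the doubling constant, the exponents and
    a bound on the [A_p] constant. This favours Lerner's argument: it needs no reverse Hoelder
    inequality, only the strong type bound for doubling measures, whose constant is explicit. One
    weight [H^(1-p0) V] serves for [p < p0] and [p > p0] alike: [|g| <= H] gives
    [|g|^p0 H^(1-p0) <= H], and the [A_1] conditions keep [H] and [V] from being small relative to
    their averages on a ball, which controls the negative powers in the weight and in its dual. The
    [4] is the product of the two factors [2] lost by the majorants. The truncation [u] is there
    because the estimate ends by dividing by [(int u^p w)^(1/p')], which must be finite and
    positive. *)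

Lemma vitali_selection (R : realType) (I T : Type) (B : I -> set T)
    (rad : I -> R) (F : set I) (M : R) :
  (forall i, F i -> [/\ 0 < rad i, rad i <= M & B i !=set0]) ->
  exists G, [/\ G `<=` F, trivIset G B &
    forall i, F i -> exists j, [/\ G j, B i `&` B j !=set0 &
      rad i <= 2 * rad j]].
Proof.
move=> FP.
pose P (G : set I) := [/\ G `<=` F, trivIset G B &
  forall i j, F i -> G j -> B i `&` B j !=set0 ->
    exists k, [/\ G k, B i `&` B k !=set0 & rad i <= 2 * rad k]].
(* Among the disjoint subfamilies such that whatever meets them meets a large
   enough member of them, a maximal one meets everything in [F]. *)
have [|G [[GF tG GP] maxG]] := @Zorn_bigcup I P.
  move=> C CP totC; split.
  - by move=> i [G /CP[GF _ _] /GF].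
  - move=> i j [G CG Gi] [H CH Hj].
    have [GH|HG] := totC _ _ CG CH.
      by have [_ + _] := CP _ CH; apply => //; exact: GH.
    by have [_ + _] := CP _ CG; apply => //; exact: HG.
  - move=> i j Fi [G CG Gj] ij; have [_ _ /(_ i j Fi Gj ij)] := CP _ CG.
    by move=> [k [Gk ik rik]]; exists k; split => //; exists G.
exists G; split=> // i Fi.
have [[j [Gj ij]]|iG] := pselect (exists j, G j /\ B i `&` B j !=set0).
  exact: GP ij.
(* If [i] meets nothing in [G], a member of [S] with radius above half the supremum can be added to
   [G], against maximality: whatever meets it either meets [G] already or lies in [S], and then has
   at most twice its radius. *)
pose S := [set j | F j /\ forall k, G k -> B j `&` B k = set0].
have Si : S i.
  by split=> // k Gk; apply: contrapT => /eqP/set0P ik; apply: iG; exists k.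
have hS : has_sup (rad @` S).
  split; first by exists (rad i); exists i.
  by exists M => _ [j [/FP[_ ? _] _] <-].
have supS0 : 0 < sup (rad @` S).
  have [ri0 _ _] := FP _ Fi.
  by apply: lt_le_trans ri0 _; apply: ub_le_sup; [case: hS|exists i].
have [_ [j [Fj Gj] <-] supj] :
    exists2 r, (rad @` S) r & sup (rad @` S) / 2 < r.
  have /(@sup_adherent _ _ _)/(_ hS)[r Sr rs] : 0 < sup (rad @` S) / 2.
    by rewrite divr_gt0.
  by exists r => //; lra.
have nGj : ~ G j.
  by move=> /Gj; rewrite setIid => Bj; case: (FP _ Fj) => _ _ [y]; rewrite Bj.
exfalso; apply: (maxG (G `|` [set j])).
  split; first by move=> k; left.
  by move=> /(_ j) GjG; apply: nGj; apply: GjG; right.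
split.
- by move=> k [/GF//|->].
- move=> k l [Gk|->] [Gl|->] //; first exact: tG.
  + by rewrite setIC (Gj _ Gk) => -[].
  + by rewrite (Gj _ Gl) => -[].
- move=> k l Fk Gl kl.
  have [[m [Gm km]]|kG] := pselect (exists m, G m /\ B k `&` B m !=set0).
    have [m' [Gm' km' rk]] := GP _ _ Fk Gm km.
    by exists m'; split => //; left.
  case: Gl => [Gl|/= ?]; first by exfalso; apply: kG; exists l.
  subst l; exists j; split=> //; first by right.
  have : rad k <= sup (rad @` S).
    apply: ub_le_sup; first by case: hS.
    exists k => //; split=> // m Gm.
    by apply: contrapT => /eqP/set0P km; apply: kG; exists m.
  by move=> ?; lra.
Qed.

(** * Measures with density *)

Section density.
Local Open Scope ereal_scope.
Context d (T : measurableType d) (R : realType).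
Context (mu : {measure set T -> \bar R}) (v : T -> R).
Context (mv : measurable_fun setT v) (v0 : forall x, (0 <= v x)%R).

(** The two proofs are arguments so that the term carries all that its declaration as a measure
    requires. *)
Definition density_measure of measurable_fun setT v & (forall x, (0 <= v x)%R)
  := fun A : set T => \int[mu]_(x in A) (v x)%:E.

Local Notation nu := (density_measure mv v0).

Let mev D : measurable_fun D (fun x => (v x)%:E).
Proof. by apply: measurable_funTS; exact/measurable_EFinP. Qed.

Let density0 : nu set0 = 0.
Proof. exact: integral_set0. Qed.

Let density_ge0 A : 0 <= nu A.
Proof. by apply: integral_ge0 => x _; rewrite lee_fin. Qed.

Let density_sigma_additive : semi_sigma_additive nu.
Proof.
move=> F mF tF mUF; rewrite /density_measure; apply: cvg_toP.
  apply: ereal_nondecreasing_is_cvgn => m n mn.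
  by apply: lee_sum_nneg_natr => // k _ _; exact: density_ge0.
by rewrite ge0_integral_bigcup//= => x _; rewrite lee_fin.
Qed.

HB.instance Definition _ := isMeasure.Build _ _ _ nu
  density0 density_ge0 density_sigma_additive.

Import HBNNSimple.

Let integral_density_nnsfun (h : {nnsfun T >-> R}) :
  \int[nu]_x (h x)%:E = \int[mu]_x ((h x)%:E * (v x)%:E).
Proof.
have hE x : (h x)%:E * (v x)%:E =
    \sum_(y \in range h) (y%:E * ((\1_(h @^-1` [set y]) x)%:E * (v x)%:E)).
  rewrite {1}fimfunE -fsumEFin// ge0_mule_fsuml => [|y].
    by apply: eq_fsbigr => y _; rewrite EFinM muleA.
  by rewrite EFinM nnfun_muleindic_ge0.
rewrite integralT_nnsfun sintegralE; under [RHS]eq_integral do rewrite hE.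
have mind (y : R) : measurable_fun setT
    (fun x => (\1_(h @^-1` [set y]) x)%:E * (v x)%:E).
  by apply: emeasurable_funM; [exact/measurable_EFinP|exact: mev].
have ind0 (y : R) x : 0 <= (\1_(h @^-1` [set y]) x)%:E * (v x)%:E.
  by rewrite mule_ge0// lee_fin.
rewrite ge0_integral_fsum//; last 2 first.
- by move=> y; exact: measurable_funeM.
- move=> y x _; rewrite muleA; apply: mule_ge0; last by rewrite lee_fin.
  exact: nnfun_muleindic_ge0.
apply: eq_fsbigr => y /[!inE] -[x _ <-].
rewrite ge0_integralZl// ?lee_fin//; congr (_ * _).
rewrite /= /density_measure [LHS]integral_mkcond; apply: eq_integral => z _.
by rewrite patchE indicE; case: ifP; rewrite ?mul1e ?mul0e.
Qed.

Let integral_densityT (f : T -> \bar R) :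
  measurable_fun setT f -> (forall x, 0 <= f x) ->
  \int[nu]_x f x = \int[mu]_x (f x * (v x)%:E).
Proof.
move=> mf f0; pose h := nnsfun_approx measurableT mf.
have mh n : measurable_fun setT (fun x => (h n x)%:E) by exact/measurable_EFinP.
have hf x : (EFin \o h n) x @[n --> \oo] --> f x.
  by apply: cvg_nnsfun_approx => // y _.
have hnd x : nondecreasing_seq (fun n => (EFin \o h n) x).
  by move=> m n mn; rewrite lee_fin; exact/lefP/nd_nnsfun_approx.
transitivity (limn (fun n => \int[nu]_x (EFin \o h n) x)).
  rewrite -monotone_convergence//; last by move=> n x _; rewrite /= lee_fin.
  by apply: eq_integral => x _; apply/esym/cvg_lim.
under eq_fun do rewrite integral_density_nnsfun.
rewrite -monotone_convergence//.
- apply: eq_integral => x _; apply/cvg_lim => //.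
  apply: cvgeZr => //. exact: hf.
- by move=> n; apply: emeasurable_funM => //; exact: mev.
- by move=> n x _; rewrite mule_ge0 ?lee_fin.
- by move=> x _ m n mn; rewrite lee_wpmul2r ?lee_fin//; exact: hnd.
Qed.

(** Describes [v dmu] by its integrals, because the later arguments change the measure under the
    integral sign; the values on sets follow in [is_densityE]. *)
Definition is_density (nu : {measure set T -> \bar R}) : Prop :=
  forall (D : set T) (f : T -> \bar R), measurable D -> measurable_fun setT f ->
  (forall x, 0 <= f x) ->
  \int[nu]_(x in D) f x = \int[mu]_(x in D) (f x * (v x)%:E).

Lemma is_densityE (m : {measure set T -> \bar R}) : is_density m ->
  forall A, measurable A -> m A = \int[mu]_(x in A) (v x)%:E.
Proof.
move=> mE A mA; rewrite -[LHS]mul1e -integral_cst// mE//.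
by apply: eq_integral => x _; rewrite mul1e.
Qed.

Lemma density_exists : exists m : {measure set T -> \bar R}, is_density m.
Proof.
exists nu => D f mD mf f0.
rewrite integral_mkcond integral_densityT.
- rewrite [RHS]integral_mkcond; apply: eq_integral => x _.
  by rewrite !patchE; case: ifP => // _; rewrite mul0e.
- by apply/(measurable_restrictT _ mD); exact: measurable_funTS.
- by apply: erestrict_ge0.
Qed.

End density.

(** * Disjoint families and quasi-metric balls *)

(** For each [n] only finitely many members have measure above [1/(n+1)]: a sequence of disjoint
    ones inside [B] would exceed [mu B]. *)
Lemma trivIset_positive_countable d (T : measurableType d) (R : realType)
    (J : Type) (mu : {measure set T -> \bar R}) (G : set J) (A : J -> set T)
    (B : set T) :
  trivIset G A -> measurable B -> (mu B < +oo)%E ->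
  (forall i, G i -> [/\ measurable (A i), A i `<=` B & (0 < mu (A i))%E]) ->
  countable G.
Proof.
move=> tA mB Bfin GA.
pose S n := [set i | G i /\ (n.+1%:R^-1%:E < mu (A i))%E].
have -> : G = \bigcup_n S n.
  apply/seteqP; split=> [i Gi|i [n _ []//]].
  have [mA AB] := GA _ Gi.
  have : (mu (A i) < +oo)%E.
    by apply: le_lt_trans Bfin; apply: le_measure => //; rewrite inE.
  case E : (mu (A i)) => [a| |]// _; rewrite lte_fin => a0.
  have := a0 => /ltr_add_invr[n]; rewrite add0r => na.
  by exists n => //; split=> //; rewrite E lte_fin.
apply: bigcup_countable => // n _; apply: finite_set_countable.
apply: contrapT => /infiniteP/card_leP/injfunPex[/= q0 _ q0inj].
pose q (k : nat) : J := val (q0 (SigSub (mem_set (I : [set: nat] k)))).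
have Sq k : S n (q k) by rewrite /q; case: (q0 _) => /= i /set_mem.
have Gq k : G (q k) by case: (Sq k).
have qinj : {in [set: nat] &, injective q}.
  move=> k l _ _ qkl; have /(congr1 val) : 
    SigSub (mem_set (I : [set: nat] k)) = SigSub (mem_set (I : [set: nat] l)).
    by apply: q0inj; rewrite ?inE//; exact: val_inj.
  by [].
have tq : trivIset setT (A \o q).
  by rewrite trivIset_comp//; apply: sub_trivIset tA => _ [k _ <-].
have : (mu (\bigcup_k A (q k)) <= mu B)%E.
  apply: le_measure; rewrite ?inE//.
    by apply: bigcup_measurable => k _; have [] := GA _ (Gq k).
  by apply: bigcup_sub => k _; have [] := GA _ (Gq k).
rewrite measure_bigcup//; last by move=> k _; have [] := GA _ (Gq k).
rewrite (@eq_eseriesl _ _ xpredT); last by move=> k; rewrite in_setT.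
have /fineK <- : mu B \is a fin_num by rewrite ge0_fin_numE.
set b := fine _.
pose m := Num.bound `|b * n.+1%:R|.
apply/negP; rewrite -ltNge.
apply: (@lt_le_trans _ _ (\sum_(0 <= k < m) n.+1%:R^-1%:E)%E).
  rewrite sumEFin lte_fin sumr_const_nat subn0 -[ltRHS]mulr_natl.
  rewrite ltr_pdivlMr ?ltr0n//; apply: le_lt_trans (ler_norm _) _.
  exact: archi_boundP.
apply: le_trans (nneseries_lim_ge m _) => //.
by apply: lee_sum => k _; have [_ /ltW] := Sq k.
Qed.

Section quasi_metric_balls.
Context (R : realType) (X : Type) (rho : X -> X -> R) (K : R).
Hypotheses (qm : quasi_metric K rho) (K1 : 1 <= K).

Let K0 : 0 < K. Proof. exact: lt_le_trans K1. Qed.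

Lemma qball_center x r : 0 < r -> qball rho x r x.
Proof. by rewrite /qball/= => ?; have [_ ->] := qm_eq0 qm x x. Qed.

Lemma sub_qball x r s : r <= s -> qball rho x r `<=` qball rho x s.
Proof. by move=> rs y /= /lt_le_trans; apply. Qed.

(** Going from [y] to [z] through [u], then through [x], costs [K (s + 2 K r)], which is at most
    [5 K^2 s] as [r <= 2 s] and [1 <= K]. For [K = 1] this is the usual factor 5 of Vitali's
    lemma. *)
Lemma qball_enlarge x y r s : 0 < s -> qball rho x r `&` qball rho y s !=set0 ->
  r <= 2 * s -> qball rho x r `<=` qball rho y (5 * K ^+ 2 * s).
Proof.
rewrite /qball => s0 [u [/= xu yu]] rs z /= xz.
have yz := qm_triangle qm y z u; have uz := qm_triangle qm u z x.
rewrite (qm_sym qm u x) in uz.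
apply: (le_lt_trans yz); apply: (@lt_le_trans _ _ (K * (s + K * (r + r)))).
  rewrite ltr_pM2l//; apply: ltr_leD => //; apply: (le_trans uz).
  by rewrite ler_pM2l// lerD// ltW.
have : K * (s + K * (r + r)) <= K * (K * s + K * (2 * s + 2 * s)).
  by rewrite ler_pM2l// lerD ?ler_peMl ?ler_pM2l ?lerD// ltW.
by move=> /le_trans; apply; rewrite le_eqVlt; apply/orP; left; apply/eqP; ring.
Qed.

End quasi_metric_balls.

(** * Maximal functions: weak type *)

Section maximal_function.
Local Open Scope ereal_scope.
Context (R : realType) d (X : measurableType d) (rho : X -> X -> R).

(** Uncentred: its superlevel sets are unions of balls, hence open and measurable, and an average
    over a ball is bounded by its value at every point of that ball. *)
Definition maximal_function (nu : {measure set X -> \bar R}) (h : X -> \bar R)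
    (x : X) : \bar R :=
  ereal_sup [set q | exists c r,
    [/\ (0 < r)%R, qball rho c r x & q = avg nu (qball rho c r) h]].

(** Kept apart from [doubling] because three measures, [mu], [w dmu] and [s dmu], share the same
    balls. *)
Record regular_quasi_metric (K : R) : Prop := RegularQuasiMetric {
  rqm_qm : quasi_metric K rho ;
  rqm_ge1 : (1 <= K)%R ;
  rqm_open : forall x r, qopen rho (qball rho x r) ;
  rqm_measurable : forall x r, measurable (qball rho x r) ;
  rqm_borel : forall U, qopen rho U -> measurable U }.

Record doubling (nu : {measure set X -> \bar R}) (D : R) : Prop := Doubling {
  dbl_ge1 : (1 <= D)%R ;
  dbl_gt0 : forall x r, (0 < r)%R -> 0 < nu (qball rho x r) ;
  dbl_lty : forall x r, (0 < r)%R -> nu (qball rho x r) < +oo ;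
  dbl_le : forall x r, (0 < r)%R ->
    nu (qball rho x (2 * r)%R) <= D%:E * nu (qball rho x r) }.

Context (K : R) (rqm : regular_quasi_metric K).
Let mball x r : measurable (qball rho x r).
Proof. exact: rqm_measurable rqm _ _. Qed.
Hint Resolve mball : core.

Lemma qopen_bigcup (I : Type) (F : set I) (U : I -> set X) :
  (forall i, F i -> qopen rho (U i)) -> qopen rho (\bigcup_(i in F) U i).
Proof.
move=> FU x [i Fi Uix]; have [r r0 rU] := FU i Fi x Uix.
by exists r => //; apply: subset_trans rU _; exact: bigcup_sup.
Qed.

Section fixed_measure.
Context (nu : {measure set X -> \bar R}) (D : R) (dbl : doubling nu D).
Local Notation M := (maximal_function nu).
Implicit Types h : X -> \bar R.

Lemma doubling_fin_num x r : nu (qball rho x r) \is a fin_num.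
Proof.
rewrite ge0_fin_numE//; have [r0|r0] := ltrP 0%R r; first exact: (dbl_lty dbl).
rewrite (_ : qball _ _ _ = set0) ?measure0// -subset0 => y /=.
by rewrite /qball/= ltNge (le_trans r0)// (qm_ge0 (rqm_qm rqm)).
Qed.

Lemma avg_le x r h (l : \bar R) : (0 < r)%R ->
  (avg nu (qball rho x r) h <= l) =
  (\int[nu]_(y in qball rho x r) h y <= l * nu (qball rho x r)).
Proof.
move=> r0; rewrite /avg -(fineK (doubling_fin_num x r)) muleC.
have n0 : (0 < fine (nu (qball rho x r)))%R.
  by rewrite fine_gt0// (dbl_gt0 dbl)// (dbl_lty dbl).
by rewrite inver gt_eqF// lee_pdivrMr.
Qed.

Lemma le_avg x r h (l : \bar R) : (0 < r)%R ->
  (l <= avg nu (qball rho x r) h) =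
  (l * nu (qball rho x r) <= \int[nu]_(y in qball rho x r) h y).
Proof.
move=> r0; rewrite /avg -(fineK (doubling_fin_num x r)) muleC.
have n0 : (0 < fine (nu (qball rho x r)))%R.
  by rewrite fine_gt0// (dbl_gt0 dbl)// (dbl_lty dbl).
by rewrite inver gt_eqF// lee_pdivlMr.
Qed.

Lemma avg_maximal_function h c r x : (0 < r)%R -> qball rho c r x ->
  avg nu (qball rho c r) h <= M h x.
Proof. by move=> r0 cx; apply: ereal_sup_ubound; exists c, r. Qed.

Lemma maximal_function_gt h l : [set x | l < M h x] =
  \bigcup_(b in [set b : X * R | (0 < b.2)%R /\
     l < avg nu (qball rho b.1 b.2) h]) qball rho b.1 b.2.
Proof.
apply/seteqP; split=> [x /ereal_sup_gt[_ [c [r [r0 cx ->]]] lc]|].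
  by exists (c, r).
move=> x [[c r] [/= r0 lc] cx].
exact: lt_le_trans lc (avg_maximal_function _ r0 cx).
Qed.

Lemma measurable_maximal_function h : measurable_fun setT (M h).
Proof.
apply: (measurability _ (ErealGenOInfty.measurableE R)) => //.
move=> _ [_ [l ->] <-]; rewrite setTI preimage_itvoy.
rewrite [X in measurable X](_ : _ = [set x | l%:E < M h x])//.
rewrite maximal_function_gt; apply: (rqm_borel rqm).
by apply: qopen_bigcup => b _; exact: (rqm_open rqm).
Qed.

Lemma maximal_function_ge0 h x : (forall y, 0 <= h y) -> 0 <= M h x.
Proof.
move=> h0; apply: le_trans (avg_maximal_function h ltr01 _); last first.
  exact: (qball_center (rqm_qm rqm)).
by rewrite /avg mule_ge0// ?inve_ge0//; exact: integral_ge0.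
Qed.

Lemma le_maximal_function h1 h2 : measurable_fun setT h1 ->
    measurable_fun setT h2 -> (forall x, 0 <= h1 x) ->
    (forall x, h1 x <= h2 x) ->
  forall x, M h1 x <= M h2 x.
Proof.
move=> m1 m2 h10 h12 x; apply: ge_ereal_sup => _ [c [r [r0 cx ->]]].
apply: le_trans (avg_maximal_function h2 r0 cx).
rewrite /avg lee_wpmul2l ?inve_ge0//.
apply: ge0_le_integral => //; [exact: measurable_funTS|exact: measurable_funTS].
Qed.

(** Cost of the enlargement by [5 K^2]: with [n = Num.bound (5 K^2)], one has [5 K^2 < n < 2^n], so
    [n] doublings are enough. *)
Definition vitali_const : R := (D ^+ Num.bound (5 * K ^+ 2))%R.

Lemma doubling_iter x r n : (0 < r)%R ->
  nu (qball rho x (2 ^+ n * r)%R) <= (D ^+ n)%:E * nu (qball rho x r).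
Proof.
move=> r0; elim: n => [|n ih]; first by rewrite !expr0 mul1r mul1e.
rewrite exprS -mulrA; apply: le_trans (dbl_le dbl _ _) _.
  by rewrite mulr_gt0// exprn_gt0.
rewrite exprS EFinM -muleA lee_wpmul2l// lee_fin.
exact: le_trans ler01 (dbl_ge1 dbl).
Qed.

Lemma doubling_enlarge x r : (0 < r)%R ->
  nu (qball rho x (5 * K ^+ 2 * r)%R) <= vitali_const%:E * nu (qball rho x r).
Proof.
move=> r0; apply: le_trans (doubling_iter x _ r0).
apply: le_measure; rewrite ?inE//; apply: sub_qball; rewrite ler_pM2r//.
apply/ltW; apply: (lt_le_trans (archi_boundP _)).
  by rewrite mulr_ge0// sqr_ge0.
by rewrite -natrX ler_nat ltnW// ltn_expl.
Qed.


Lemma vitali_const_ge0 : 0 <= vitali_const%:E.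
Proof. by rewrite lee_fin exprn_ge0// (le_trans ler01)// (dbl_ge1 dbl). Qed.

(** The enlargements of the disjoint balls chosen by Vitali's lemma cover the union, and each chosen
    ball satisfies [l nu(ball) < int h] over itself. The bound [r0] on the radii is for the
    selection, the set [B] of finite measure for its countability. *)
Lemma weak_type_bounded h (l : R) (F : set (X * R)) (B : set X) (r0 : R) :
  measurable_fun setT h -> (forall x, 0 <= h x) -> (0 < l)%R ->
  measurable B -> nu B < +oo ->
  (forall b, F b -> [/\ (0 < b.2 <= r0)%R, qball rho b.1 b.2 `<=` B &
     l%:E < avg nu (qball rho b.1 b.2) h]) ->
  l%:E * nu (\bigcup_(b in F) qball rho b.1 b.2) <=
  vitali_const%:E * \int[nu]_x h x.
Proof.
move=> mh h0 l0 mB Bfin FP.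
pose ball (b : X * R) := qball rho b.1 b.2.
pose big (b : X * R) := qball rho b.1 (5 * K ^+ 2 * b.2)%R.
have [|G [GF tG GP]] := @vitali_selection R (X * R)%type X ball snd F r0.
  move=> b /FP[/andP[b0 br] _ _]; split=> //; exists b.1.
  exact: (qball_center (rqm_qm rqm)).
have G0 g : G g -> (0 < g.2)%R by move=> /GF/FP[/andP[]].
have /countable_injP[f finj] : countable G.
  apply: (trivIset_positive_countable tG mB Bfin) => g Gg; split.
  - exact: mball.
  - by have [] := FP _ (GF _ Gg).
  - exact: (dbl_gt0 dbl _ (G0 _ Gg)).
(* [S n] is the chosen ball with code [n], or empty; unions over [G] thus become unions over [nat],
   and sums become series. *)
pose S n := [set g | G g /\ f g = n].
pose E n := \bigcup_(g in S n) big g.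
pose A n := \bigcup_(g in S n) ball g.
have SP n : (exists g, S n = [set g] /\ G g) \/ S n = set0.
  have [[g [Gg fg]]|nS] := pselect (exists g, S n g).
    left; exists g; split=> //; apply/seteqP; split=> [g' [Gg' fg']|_ ->//].
    by apply: finj; rewrite ?inE// fg fg'.
  by right; rewrite -subset0 => g Sg; apply: nS; exists g.
have mA n : measurable (A n).
  by rewrite /A; have [[g [-> _]]|->] := SP n;
    rewrite ?bigcup_set1 ?bigcup_set0//; exact: mball.
have mE n : measurable (E n).
  by rewrite /E; have [[g [-> _]]|->] := SP n;
    rewrite ?bigcup_set1 ?bigcup_set0//; exact: mball.
have tA : trivIset setT A.
  move=> m n _ _ [x [[g [Gg <-] gx] [g' [Gg' <-] gx']]].
  by congr f; apply: tG => //; exists x.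
have l00 : 0 <= l%:E by rewrite lee_fin ltW.
have lE n : l%:E * nu (E n) <= vitali_const%:E * \int[nu]_(x in A n) h x.
  rewrite /E /A; have [[g [-> Gg]]|->] := SP n.
    rewrite !bigcup_set1.
    apply: le_trans (lee_wpmul2l l00 (doubling_enlarge g.1 (G0 _ Gg))) _.
    rewrite muleCA lee_wpmul2l ?vitali_const_ge0//.
    by have [_ _ /ltW] := FP _ (GF _ Gg); rewrite le_avg// G0.
  by rewrite !bigcup_set0 measure0 mule0 integral_set0 mule0.
have OE : \bigcup_(b in F) ball b `<=` \bigcup_n E n.
  move=> x [b Fb bx]; have [g [Gg bg rbg]] := GP _ Fb.
  exists (f g) => //; exists g => //.
  exact: (qball_enlarge (rqm_qm rqm) (rqm_ge1 rqm) (G0 _ Gg) bg rbg).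
have mO : measurable (\bigcup_(b in F) ball b).
  by apply: (rqm_borel rqm); apply: qopen_bigcup => b _; exact: (rqm_open rqm).
apply: le_trans (lee_wpmul2l l00 (measure_sigma_subadditive nu mE mO OE)) _.
rewrite -nneseriesZl//.
apply: (@le_trans _ _ (\sum_(0 <= n <oo)
    (vitali_const%:E * \int[nu]_(x in A n) h x))).
  by apply: lee_nneseries => // n _; rewrite mule_ge0.
rewrite nneseriesZl//; last by move=> n _; exact: integral_ge0.
apply: lee_wpmul2l; first exact: vitali_const_ge0.
rewrite -ge0_integral_bigcup//; last exact: measurable_funTS.
by apply: ge0_subset_integral => //; exact: bigcup_measurable.
Qed.

(** Balls with radius and distance of the centre from [x0] bounded by [n+1] all lie in one ball,
    where the bounded case applies. Its constant is independent of [n], so continuity from below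
    gives the general case. *)
Lemma weak_type h (l : R) :
  measurable_fun setT h -> (forall x, 0 <= h x) -> (0 < l)%R ->
  l%:E * nu [set x | l%:E < M h x] <= vitali_const%:E * \int[nu]_x h x.
Proof.
move=> mh h0 l0.
have [[x0 _]|noX] := pselect (exists x : X, True); last first.
  rewrite (_ : [set x | _] = set0) ?measure0 ?mule0.
    by rewrite mule_ge0 ?vitali_const_ge0//; exact: integral_ge0.
  by rewrite -subset0 => x _; apply: noX; exists x.
have K0 : (0 < K)%R by exact: lt_le_trans (rqm_ge1 rqm).
pose F n := [set b : X * R | [/\ (0 < b.2 <= n.+1%:R)%R,
  (rho x0 b.1 < n.+1%:R)%R & l%:E < avg nu (qball rho b.1 b.2) h]].
pose O n := \bigcup_(b in F n) qball rho b.1 b.2.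
have mO n : measurable (O n).
  by apply: (rqm_borel rqm); apply: qopen_bigcup => b _; exact: (rqm_open rqm).
have OE : [set x | l%:E < M h x] = \bigcup_n O n.
  rewrite maximal_function_gt; apply/seteqP; split=> [x [b [b0 lb] bx]|].
    pose n := (maxn (Num.bound b.2) (Num.bound (rho x0 b.1))).
    exists n => //; exists b => //; split=> //.
      rewrite b0/= ltW//; apply: (lt_le_trans (archi_boundP (ltW b0))).
      by rewrite ler_nat (leq_trans (leq_maxl _ (Num.bound (rho x0 b.1)))).
    apply: (lt_le_trans (archi_boundP (qm_ge0 (rqm_qm rqm) _ _))).
    by rewrite ler_nat (leq_trans (leq_maxr (Num.bound b.2) _)).
  by move=> x [n _ [b [/andP[b0 _] _ lb] bx]]; exists b.
have ndO : {homo O : n m / (n <= m)%N >-> (n <= m)%O}.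
  move=> m n mn; apply/subsetPset => x [b [/andP[b0 bm] bx0 lb] bx].
  have mn' : (m.+1%:R <= n.+1%:R :> R)%R by rewrite ler_nat.
  by exists b => //; split=> //; rewrite ?b0 ?(le_trans bm)// (lt_le_trans bx0).
have lO n : nu (O n) <= l^-1%:E * (vitali_const%:E * \int[nu]_x h x).
  rewrite lee_pdivlMl//.
  apply: (@weak_type_bounded h l _ (qball rho x0 (K * (n.+1%:R + n.+1%:R)))
    n.+1%:R) => //.
    by rewrite ltey_eq doubling_fin_num.
  move=> b [/andP[b0 bn] bx0 lb]; split=> //; first by rewrite b0.
  move=> y /= by_; apply: le_lt_trans (qm_triangle (rqm_qm rqm) _ _ b.1) _.
  by rewrite ltr_pM2l// ltrD// (lt_le_trans by_).
have cO : (nu \o O) n @[n --> \oo] --> nu (\bigcup_n O n).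
  exact: (nondecreasing_cvg_mu mO (bigcup_measurable (fun i _ => mO i)) ndO).
rewrite -lee_pdivlMl// OE -(cvg_lim _ cO)//.
apply: lime_le; first exact: cvgP cO.
by apply: nearW => n; exact: lO.
Qed.

End fixed_measure.
End maximal_function.

(** * Marcinkiewicz interpolation *)

Section dyadic_sums.
Context (R : realType) (a s : R).
Hypotheses (a0 : 0 < a) (s0 : 0 < s).
Local Notation t k := (a * 2 ^+ k).

(** The geometric series [sum_j 2^(-s j)], which compares a sum of powers of dyadic levels with its
    largest term. *)
Definition dyadic_const : R := 2 `^ s / (2 `^ s - 1).

Let two_gt1 : 1 < 2 `^ s :> R.
Proof.
have /(_ 1 2) := @gt0_ltr_powR R s s0; rewrite powR1; apply.
- by rewrite nnegrE.
- by rewrite nnegrE.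
- by rewrite ltr1n.
Qed.

Lemma dyadic_const_gt0 : 0 < dyadic_const.
Proof. by rewrite divr_gt0 ?subr_gt0// (lt_trans ltr01). Qed.

Let sum_dyadic n : \sum_(k < n.+1) t k `^ s <= dyadic_const * t n `^ s.
Proof.
have th := two_gt1; have thN0 : 2 `^ s - 1 != 0 :> R by rewrite subr_eq0 gt_eqF.
elim: n => [|n ih].
  rewrite big_ord1 ler_peMl ?powR_ge0// /dyadic_const ler_pdivlMr ?subr_gt0//.
  by rewrite mul1r gerBl.
rewrite big_ord_recr/=; apply: le_trans (lerD ih (lexx _)) _.
have -> : t n.+1 `^ s = 2 `^ s * t n `^ s.
  by rewrite exprS mulrCA (@powRM _ 2) ?mulr_ge0 ?exprn_ge0 ?(ltW a0).
rewrite le_eqVlt; apply/orP; left; apply/eqP; rewrite /dyadic_const.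
by field.
Qed.

Lemma sum_dyadic_lt (z : R) n : 0 <= z ->
  \sum_(k < n) (if t k < z then t k `^ s else 0) <= dyadic_const * z `^ s.
Proof.
move=> z0; elim: n => [|n ih].
  by rewrite big_ord0 mulr_ge0 ?powR_ge0// ltW// dyadic_const_gt0.
have [tz|zt] := ltP (t n) z; last by rewrite big_ord_recr/= ltNge zt/= addr0.
apply: (@le_trans _ _ (\sum_(k < n.+1) t k `^ s)).
  by apply: ler_sum => k _; case: ifP => // _; exact: powR_ge0.
apply: le_trans (sum_dyadic n) _; rewrite ler_pM2l ?dyadic_const_gt0//.
by rewrite ge0_ler_powR ?nnegrE ?(ltW s0) ?mulr_ge0 ?exprn_ge0 ?(ltW a0)
  ?(ltW tz).
Qed.

Lemma dyadic_floor (y : R) : a < y -> exists k, t k < y <= t k.+1.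
Proof.
move=> ay.
have ex : exists k, y <= t k.+1.
  exists (Num.bound (y / a)); rewrite mulrC -ler_pdivrMr//.
  apply/ltW; apply: lt_le_trans (archi_boundP _) _.
    by rewrite divr_ge0// ltW// (lt_trans a0).
  by rewrite -natrX ler_nat ltnW// (ltn_trans (ltn_expl _ (ltnSn 1)))//
    ltn_exp2l.
have [[|k] yk kmin] := ex_minnP ex.
  by exists 0%N; rewrite expr0 mulr1 ay.
exists k.+1; rewrite yk andbT ltNge; apply/negP => /kmin.
by rewrite ltnn.
Qed.

End dyadic_sums.

Section marcinkiewicz.
Local Open Scope ereal_scope.
Context d (T : measurableType d) (R : realType).
Context (nu : {measure set T -> \bar R}) (F H : T -> \bar R) (A q : R).
Hypotheses (mF : measurable_fun setT F) (mH : measurable_fun setT H).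
Hypotheses (F0 : forall x, 0 <= F x) (H0 : forall x, 0 <= H x).
Hypotheses (A0 : (0 <= A)%R) (q1 : (1 < q)%R).
Hypothesis weak : forall l : R, (0 < l)%R -> l%:E * nu
  [set x : T | l%:E < F x] <=
  A%:E * \int[nu]_(x in [set x : T | (l / 2)%:E < H x]) H x.

(** [2^q] pays for rounding [F] up to the next level, [A] for the weak type bound, and the last
    factor for summing [(t k)^(q-1)] over the levels below [2 H x]. *)
Definition marcinkiewicz_const : R :=
  2 `^ q * A * (dyadic_const (q - 1) * 2 `^ (q - 1)).

Let q0 : (0 < q)%R. Proof. exact: lt_trans ltr01 q1. Qed.
Let s0 : (0 < q - 1)%R. Proof. by rewrite subr_gt0. Qed.

Let mgt (G : T -> \bar R) l : measurable_fun setT G ->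
  measurable [set x : T | l < G x].
Proof. by move=> mG; rewrite -[X in measurable X]setTI; exact:
  emeasurable_fun_o_infty. Qed.

(* The dyadic levels start at [a > 0] so that they are indexed by [nat]; the
   bounds are uniform in [a], which then tends to [0]. *)
Section level.
Context (a : R) (a0 : (0 < a)%R).
Local Notation t k := (a * 2 ^+ k)%R.

Let t_gt0 k : (0 < t k)%R. Proof. by rewrite mulr_gt0// exprn_gt0. Qed.

Let level_sum x : a%:E < F x -> F x `^ q <=
  \sum_(k <oo) ((t k.+1 `^ q)%:E * (\1_[set x : T | ((t k)%:E < F x)%E] x)%:E).
Proof.
set S := (X in _ <= X).
have key (y : R) : (a < y)%R -> y%:E <= F x -> (y `^ q)%:E <= S.
  move=> ay yF; have [k /andP[ty yt]] := dyadic_floor a0 ay.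
  have y0 : (0 <= y)%R by rewrite ltW// (lt_trans a0).
  apply: le_trans (nneseries_lim_ge k.+1 _); last first.
    by move=> n _ _; rewrite mule_ge0// lee_fin// powR_ge0.
  rewrite big_nat_recr//=; apply: le_trans (leeDr _ _); last first.
    by apply: sume_ge0 => n _; rewrite mule_ge0// lee_fin// powR_ge0.
  rewrite indicE mem_set//=; last by rewrite (lt_le_trans _ yF)// lte_fin.
  by rewrite mule1 lee_fin ge0_ler_powR ?nnegrE ?(ltW (t_gt0 _))// ltW.
case Fx : (F x) => [y| |] aF; last by [].
  by apply: key; rewrite ?Fx// -lte_fin.
rewrite poweRyr ?gt_eqF// leye_eq; apply/eqP/eqyP => z z0.
(* Where [F x] is infinite the sum must exceed every [z > 0]; [y] is a finite height above [a] with
   [y^q >= z]. *)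
pose y := Num.max (a + 1)%R (z `^ q^-1)%R.
apply: le_trans (key y _ _); last 2 first.
- by rewrite lt_max ltrDl ltr01.
- by rewrite Fx leey.
rewrite lee_fin; apply: (@le_trans _ _ ((z `^ q^-1) `^ q)%R).
  by rewrite -powRrM mulVf ?gt_eqF// powRr1// ltW.
apply: ge0_ler_powR; rewrite ?nnegrE ?powR_ge0 ?(ltW q0)//.
  by rewrite le_max (ltW (addr_gt0 a0 ltr01)).
by rewrite le_max lexx orbT.
Qed.

Let P k := (fun x => (t k `^ (q - 1))%:E * H x) \_
  [set x : T | (t k / 2)%:E < H x].

Let P_ge0 k x : 0 <= P k x.
Proof.
rewrite /P patchE; case: ifP => // _; rewrite mule_ge0// lee_fin powR_ge0//.
Qed.

Let mP k : measurable_fun setT (P k).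
Proof.
apply/(measurable_restrictT _ (mgt _ mH)); apply: measurable_funTS.
exact: measurable_funeM.
Qed.

Let level_measure k :
  (t k.+1 `^ q)%:E * nu [set x : T | (t k)%:E < F x] <=
  (2 `^ q * A)%:E * \int[nu]_x P k x.
Proof.
rewrite -integral_mkcond ge0_integralZl ?lee_fin ?powR_ge0//; last 2 first.
- exact: mgt.
- exact: measurable_funTS.
have -> : (t k.+1 `^ q = (2 `^ q * t k `^ (q - 1)) * t k)%R.
  by rewrite -mulrA (mulrC _ (t k)) mulr_powRB1 ?(ltW (t_gt0 _))//
    exprS mulrCA (@powRM _ 2) ?(ltW (t_gt0 _)).
rewrite EFinM -muleA; apply: (@le_trans _ _ ((2 `^ q * t k `^ (q - 1))%:E *
    (A%:E * \int[nu]_(x in [set x : T | (t k / 2)%:E < H x]) H x))).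
  by rewrite lee_wpmul2l ?lee_fin ?mulr_ge0 ?powR_ge0//; exact: weak.
by rewrite !EFinM -!muleA (muleCA _ A%:E).
Qed.

Let sumP x : \sum_(k <oo) P k x <=
  (dyadic_const (q - 1) * 2 `^ (q - 1))%:E * H x `^ q.
Proof.
have c0 : (0 < dyadic_const (q - 1) * 2 `^ (q - 1) :> R)%R.
  by rewrite mulr_gt0 ?dyadic_const_gt0// powR_gt0.
move: (H0 x); case Hx : (H x) => [y| |]//; last first.
  by rewrite poweRyr ?gt_eqF// gt0_muley ?leey// lte_fin.
rewrite lee_fin => y0; apply: lime_le; first exact: is_cvg_nneseries.
apply: nearW => n; rewrite big_mkord.
have -> : \sum_(k < n) P k x = (\sum_(k < n)
    (if (t k < 2 * y)%R then t k `^ (q - 1) else 0) * y)%R%:E.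
  rewrite -sumEFin; apply: eq_bigr => k _; rewrite /P patchE.
  have -> : (x \in [set x : T | (t k / 2)%:E < H x]) = (t k < 2 * y)%R.
    by apply/idP/idP; rewrite inE/= Hx lte_fin ltr_pdivrMr// (mulrC y).
  by case: ifP => _; rewrite ?Hx ?mul0r.
rewrite -mulr_suml lee_fin.
apply: le_trans (ler_wpM2r y0 (sum_dyadic_lt a0 s0 n _)) _.
  by rewrite mulr_ge0.
by rewrite powRM// -!mulrA (mulrC _ y) mulr_powRB1.
Qed.

(** A discrete layer cake: [F^q] is dominated by a sum over levels, [weak] bounds each level, and
    exchanging sum and integral leaves at [x] a geometric sum that stops at [2 H x]. *)
Lemma marcinkiewicz_level :
  \int[nu]_(x in [set x : T | a%:E < F x]) (F x `^ q) <=
  marcinkiewicz_const%:E * \int[nu]_x (H x `^ q).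
Proof.
have mFq : measurable_fun setT (fun x => F x `^ q).
  exact: (measurableT_comp (measurable_poweR _)).
have mHq : measurable_fun setT (fun x => H x `^ q).
  exact: (measurableT_comp (measurable_poweR _)).
pose S k x := (t k.+1 `^ q)%:E * (\1_[set x : T | ((t k)%:E < F x)%E] x)%:E.
have S0 k x : 0 <= S k x by rewrite mule_ge0// lee_fin// powR_ge0.
have mS k : measurable_fun setT (S k).
  apply: measurable_funeM; apply/measurable_EFinP; apply: measurable_indic.
  exact: mgt.
have mSS : measurable_fun setT (fun x => \sum_(k <oo) S k x).
  exact: ge0_emeasurable_sum.
apply: (@le_trans _ _ (\int[nu]_x (\sum_(k <oo) S k x))).
  apply: (@le_trans _ _ (\int[nu]_(x in [set x : T | a%:E < F x])
      (\sum_(k <oo) S k x))).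
    apply: ge0_le_integral => //.
    - exact: mgt.
    - by move=> x _; exact: poweR_ge0.
    - exact: measurable_funTS.
    - exact: measurable_funTS.
  apply: ge0_subset_integral => //; first exact: mgt.
  by move=> x _; exact: nneseries_ge0.
rewrite integral_nneseries//.
apply: (@le_trans _ _ (\sum_(k <oo) ((2 `^ q * A)%:E * \int[nu]_x P k x))).
  apply: lee_nneseries => [k _ _|k _]; first exact: integral_ge0.
  rewrite ge0_integralZl// ?lee_fin ?powR_ge0//; last first.
    by apply/measurable_EFinP; apply: measurable_indic; exact: mgt.
  by rewrite integral_indic ?setIT//; exact: mgt.
rewrite nneseriesZl; last by move=> k _; exact: integral_ge0.
rewrite -integral_nneseries// [marcinkiewicz_const%:E]EFinM -muleA.
have c0 : (0 <= dyadic_const (q - 1) * 2 `^ (q - 1) :> R)%R.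
  by rewrite mulr_ge0 ?powR_ge0// ltW// dyadic_const_gt0.
rewrite lee_wpmul2l ?lee_fin ?mulr_ge0 ?powR_ge0//.
rewrite -ge0_integralZl//; last by move=> x _; exact: poweR_ge0.
apply: ge0_le_integral => //.
- by move=> x _; exact: nneseries_ge0.
- exact: ge0_emeasurable_sum.
- exact: measurable_funeM.
Qed.

End level.

Lemma marcinkiewicz :
  \int[nu]_x (F x `^ q) <= marcinkiewicz_const%:E * \int[nu]_x (H x `^ q).
Proof.
have mFq : measurable_fun setT (fun x => F x `^ q).
  exact: (measurableT_comp (measurable_poweR _)).
pose E n := [set x : T | n.+1%:R^-1%:E < F x].
have EF : \int[nu]_x (F x `^ q) = \int[nu]_(x in \bigcup_n E n) (F x `^ q).
  rewrite [RHS]integral_mkcond; apply: eq_integral => x _; rewrite patchE.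
  case: ifPn => // /negP xE; apply/eqP; rewrite poweR_eq0//.
  rewrite (gt_eqF q0) andbT eq_le F0 andbT leNgt; apply/negP => Fx.
  apply: xE; rewrite inE; move: Fx; rewrite /E.
  case Fx : (F x) => [y| |]//; last by exists 0%N => //=; rewrite Fx ltry.
  rewrite lte_fin => /ltr_add_invr[n]; rewrite add0r => ny.
  by exists n => //=; rewrite Fx lte_fin.
have ndE : nondecreasing_seq E.
  move=> m n mn; apply/subsetPset => x; apply: le_lt_trans.
  by rewrite lee_fin lef_pV2 ?posrE// ler_nat.
have cE : \int[nu]_(x in E n) (F x `^ q) @[n --> \oo] -->
    \int[nu]_(x in \bigcup_n E n) (F x `^ q).
  apply: ge0_nondecreasing_set_cvg_integral => //.
  - by move=> n; exact: mgt.
  - by move=> n; exact: measurable_funTS.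
  - by move=> n x _; exact: poweR_ge0.
rewrite EF -(cvg_lim _ cE)//; apply: lime_le; first exact: cvgP cE.
by apply: nearW => n; exact: marcinkiewicz_level.
Qed.

End marcinkiewicz.

(** * Powers of extended reals and Hoelder's inequality on a set *)

Section ereal_powers.
Local Open Scope ereal_scope.
Context (R : realType).
Implicit Types (x y : \bar R) (r : R).

Lemma lee_poweR x y r : (0 <= r)%R -> 0 <= x -> x <= y -> x `^ r <= y `^ r.
Proof.
move=> r0 x0 xy; apply: gt0_ler_poweR => //; rewrite in_itv/= leey andbT//.
exact: le_trans xy.
Qed.

Lemma poweRK x r : r != 0%R -> 0 <= x -> (x `^ r) `^ r^-1 = x.
Proof. by move=> r0 x0; rewrite -poweRrM mulfV// poweRe1. Qed.

End ereal_powers.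

Section integral_lemmas.
Local Open Scope ereal_scope.
Context d (T : measurableType d) (R : realType)
  (mu : {measure set T -> \bar R}).

Lemma ge0_hoelder (D : set T) (u v : T -> R) (p q : R) :
  measurable D -> measurable_fun setT u -> measurable_fun setT v ->
  (forall x, 0 <= u x)%R -> (forall x, 0 <= v x)%R ->
  (0 < p)%R -> (0 < q)%R -> (p^-1 + q^-1 = 1)%R ->
  \int[mu]_(x in D) (u x * v x)%:E <=
  (\int[mu]_(x in D) (u x `^ p)%:E) `^ p^-1 *
  (\int[mu]_(x in D) (v x `^ q)%:E) `^ q^-1.
Proof.
move=> mD mu_ mv u0 v0 p0 q0 pq.
have mr (f : T -> R) : measurable_fun setT f -> measurable_fun setT (f \_ D).
  by move=> mf; apply/(measurable_restrictT _ mD); exact: measurable_funTS.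
have N (f : T -> R) r : (0 < r)%R -> (forall x, 0 <= f x)%R ->
    'N[mu]_r%:E[EFin \o (f \_ D)] = (\int[mu]_(x in D) (f x `^ r)%:E) `^ r^-1.
  move=> r0 f0; rewrite unlock; congr (_ `^ _).
  rewrite [RHS]integral_mkcond; apply: eq_integral => x _ /=.
  rewrite !patchE; case: ifP => _; first by rewrite ger0_norm.
  by rewrite normr0 powR0 ?gt_eqF.
have := hoelder mu (mr _ mu_) (mr _ mv) p0 q0 pq.
rewrite !N// Lnorm1 => /(le_trans _); apply.
rewrite integral_mkcond le_eqVlt; apply/orP; left; apply/eqP.
apply: eq_integral => x _ /=; rewrite !patchE; case: ifP => _.
  by rewrite ger0_norm// mulr_ge0.
by rewrite mulr0 normr0.
Qed.

Lemma integral_pos_gt0 (D : set T) (v : T -> R) : measurable D -> 0 < mu D ->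
  measurable_fun setT v -> (forall x, 0 < v x)%R ->
  0 < \int[mu]_(x in D) (v x)%:E.
Proof.
move=> mD D0 mv v0; rewrite lt0e integral_ge0 ?andbT; last first.
  by move=> x _; rewrite lee_fin ltW.
apply/eqP => iv0.
have mvE : measurable_fun D (fun x => (v x)%:E).
  by apply: measurable_funTS; exact/measurable_EFinP.
have : \int[mu]_(x in D) `|(v x)%:E| = 0.
  by rewrite -[RHS]iv0; apply: eq_integral => x _; rewrite gee0_abs// lee_fin
    ltW.
move=> /(ae_eq_integral_abs mu mD mvE)[N [mN N0 DN]].
have : mu D <= mu N.
  apply: le_measure; rewrite ?inE// => x Dx; apply: DN => /= /(_ Dx)[vx].
  by have := v0 x; rewrite vx ltxx.
by rewrite N0 leNgt D0.
Qed.

End integral_lemmas.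

(** * Strong type bound for the maximal operator of a doubling measure *)

Section strong_type.
Local Open Scope ereal_scope.
Context (R : realType) d (X : measurableType d) (rho : X -> X -> R).
Context (K : R) (rqm : regular_quasi_metric rho K).
Context (nu : {measure set X -> \bar R}) (D : R) (dbl : doubling rho nu D).
Local Notation M := (maximal_function rho nu).

Definition strong_const (q : R) : R := marcinkiewicz_const
  (2 * vitali_const K D) q.

Lemma strong_const_ge0 q : (1 < q)%R -> (0 <= strong_const q)%R.
Proof.
move=> q1; have V0 := vitali_const_ge0 K dbl; rewrite lee_fin in V0.
have dc : (0 <= dyadic_const (q - 1) :> R)%R.
  by rewrite ltW// dyadic_const_gt0// subr_gt0.
apply: mulr_ge0; apply: mulr_ge0; rewrite ?powR_ge0//.
by rewrite mulr_ge0.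
Qed.

Lemma strong_type h (q : R) : (1 < q)%R ->
  measurable_fun setT h -> (forall x, 0 <= h x) ->
  \int[nu]_x (M h x `^ q) <= (strong_const q)%:E * \int[nu]_x (h x `^ q).
Proof.
move=> q1 mh h0; apply: marcinkiewicz => //.
- exact: measurable_maximal_function rqm _ _.
- by move=> x; exact: (maximal_function_ge0 rqm).
- by rewrite mulr_ge0//; have := vitali_const_ge0 K dbl; rewrite lee_fin.
(* The part of [h] below height [l/2] adds at most [l/2] to the maximal function, so [M h > l]
   forces [M h' > l/2]. The weak type bound at height [l/2] explains the factor 2 in
   [strong_const]. *)
move=> l l0; pose E := [set x | (l / 2)%:E < h x].
have mE : measurable E.
  by rewrite -[E]setTI; exact: emeasurable_fun_o_infty.
have l20 : (0 < l / 2)%R by rewrite divr_gt0.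
pose h' := h \_ E.
have mh' : measurable_fun setT h'.
  by apply/(measurable_restrictT _ mE); exact: measurable_funTS.
have h'0 x : 0 <= h' x by apply: erestrict_ge0.
have hh' x : h x <= h' x + (l / 2)%:E.
  rewrite /h' patchE; case: ifPn; first by rewrite leeDl// lee_fin ltW.
  by rewrite notin_setE => /negP; rewrite add0e -leNgt.
have Mh' x : M h x <= M h' x + (l / 2)%:E.
  apply: ge_ereal_sup => _ [c [r [r0 cx ->]]].
  rewrite (avg_le rqm dbl)//.
  apply: (@le_trans _ _ (\int[nu]_(y in qball rho c r) (h' y + (l / 2)%:E))).
    apply: ge0_le_integral => //; first exact: (rqm_measurable rqm).
    - exact: measurable_funTS.
    - by apply: emeasurable_funD => //; exact: measurable_funTS.
  rewrite ge0_integralD//; last 3 first.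
  - exact: (rqm_measurable rqm).
  - exact: measurable_funTS.
  - by move=> y _; rewrite lee_fin ltW.
  rewrite integral_cst; last exact: (rqm_measurable rqm).
  rewrite muleDl ?(doubling_fin_num rqm dbl)//; last first.
    by rewrite ge0_adde_def// inE; [exact: (maximal_function_ge0 rqm)|
      rewrite lee_fin ltW].
  rewrite leeD2r// -(avg_le rqm dbl)//.
  exact: avg_maximal_function.
have sub : [set x | l%:E < M h x] `<=` [set x | (l / 2)%:E < M h' x].
  move=> x /= lM; have := lt_le_trans lM (Mh' x).
  rewrite {1}(splitr l) EFinD lteD2rE//.
have mgt f (k : \bar R) : measurable [set x | k < M f x].
  rewrite -[X in measurable X]setTI; apply: emeasurable_fun_o_infty => //.
  exact: measurable_maximal_function rqm _ _.
apply: (@le_trans _ _ (l%:E * nu [set x | (l / 2)%:E < M h' x])).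
  rewrite lee_wpmul2l ?lee_fin ?(ltW l0)//.
  by apply: le_measure; rewrite ?inE//; exact: mgt.
have -> : l%:E = 2%:E * (l / 2)%:E by rewrite -EFinM mulrC divfK.
rewrite [(2 * vitali_const _ _)%:E]EFinM -!muleA lee_wpmul2l//.
apply: le_trans (weak_type rqm dbl mh' h'0 l20) _.
by rewrite [in leLHS]/h' -integral_mkcond.
Qed.

End strong_type.

(** * Muckenhoupt's theorem *)

Section muckenhoupt.
Local Open Scope ereal_scope.
Context (R : realType) d (X : measurableType d) (rho : X -> X -> R).
Context (K : R) (rqm : regular_quasi_metric rho K).
Context (mu : {measure set X -> \bar R}) (D : R) (dbl : doubling rho mu D).
Implicit Types (p a : R) (w s : X -> R).

(* [w] is an everywhere positive version of an [A_p] weight, so that its dual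
   weight [s] is real-valued; [a] bounds the [A_p] constant. *)
Record Ap_pair p a w s : Prop := ApPair {
  ap_mw : measurable_fun setT w ;
  ap_ms : measurable_fun setT s ;
  ap_w0 : forall x, (0 < w x)%R ;
  ap_sE : forall x, s x = (w x `^ (- (p - 1)^-1))%R ;
  ap_le : forall x r, (0 < r)%R ->
    avg mu (qball rho x r) (EFin \o w) *
    avg mu (qball rho x r) (EFin \o s) `^ (p - 1) <= a%:E }.

Let mball x r : measurable (qball rho x r).
Proof. exact: rqm_measurable rqm _ _. Qed.
Hint Resolve mball : core.

Lemma avgE x r f : (0 < r)%R -> avg mu (qball rho x r) f =
  ((fine (mu (qball rho x r)))^-1)%:E * \int[mu]_(y in qball rho x r) f y.
Proof.
move=> r0; rewrite /avg -{1}(fineK (doubling_fin_num rqm dbl x r)) inver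
  gt_eqF//.
by rewrite fine_gt0// (dbl_gt0 dbl)// (dbl_lty dbl).
Qed.

Lemma ap_s0 p a w s : Ap_pair p a w s -> forall x, (0 < s x)%R.
Proof. by move=> wA x; rewrite (ap_sE wA) powR_gt0// (ap_w0 wA). Qed.

(** With [p' = p/(p-1)] one has [p' - 1 = 1/(p-1)], and raising the [A_p] inequality to that power
    exchanges [w] and [s]. *)
Lemma Ap_pair_dual p a w s : (1 < p)%R -> Ap_pair p a w s ->
  Ap_pair (p / (p - 1)) (a `^ (p - 1)^-1) s w.
Proof.
move=> p1 wA; have p10 : (p - 1 != 0)%R by rewrite subr_eq0 gt_eqF.
have pE : (p / (p - 1) - 1 = (p - 1)^-1)%R by field.
split; [exact: ap_ms wA|exact: ap_mw wA|exact: ap_s0 wA| |].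
  move=> x; rewrite (ap_sE wA) pE invrK -powRrM mulrNN mulVf// powRr1//.
  exact/ltW/(ap_w0 wA).
move=> x r r0; rewrite pE.
have avg0 v : (forall y, 0 < v y)%R -> 0 <= avg mu (qball rho x r) (EFin \o v).
  move=> v0; rewrite avgE// mule_ge0 ?lee_fin ?invr_ge0 ?fine_ge0//.
  by apply: integral_ge0 => y _; rewrite lee_fin ltW.
have aw := avg0 _ (ap_w0 wA); have as_ := avg0 _ (ap_s0 wA).
have i0 : (0 <= (p - 1)^-1)%R by rewrite invr_ge0 subr_ge0 ltW.
have := lee_poweR i0 (mule_ge0 aw (poweR_ge0 _ _)) (ap_le wA x r0).
by rewrite poweRM ?poweR_ge0// poweRK// muleC.
Qed.

(** The average of [s] is positive, so an infinite integral of [w] would make the [A_p] product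
    infinite. *)
Lemma Ap_pair_lty p a w s x r : Ap_pair p a w s -> (0 < r)%R ->
  \int[mu]_(y in qball rho x r) (w y)%:E < +oo.
Proof.
move=> wA r0; have := ap_le wA x r0.
have m0 : (0 < (fine (mu (qball rho x r)))^-1)%R.
  by rewrite invr_gt0 fine_gt0// (dbl_gt0 dbl)// (dbl_lty dbl).
rewrite !avgE//; set W := \int[mu]_(y in _) _; set S := \int[mu]_(y in _) _.
have S0 : 0 < S.
  apply: integral_pos_gt0 => //; first exact: (dbl_gt0 dbl).
  - exact: ap_ms wA.
  - exact: ap_s0 wA.
rewrite ltNge leye_eq; apply: contraTN => /eqP ->.
by rewrite gt0_muley ?lte_fin// gt0_mulye ?leye_eq// poweR_gt0// mule_gt0.
Qed.

Lemma Ap_pair_weight_gt0 p a w s x r : Ap_pair p a w s -> (0 < r)%R ->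
  0 < \int[mu]_(y in qball rho x r) (w y)%:E.
Proof.
move=> wA r0; apply: integral_pos_gt0 => //; first exact: (dbl_gt0 dbl).
- exact: ap_mw wA.
- exact: ap_w0 wA.
Qed.

(** Hoelder's inequality for [1 = w^(1/p) w^(-1/p)], raised to the power [p]. *)
Lemma Ap_pair_measure_le p a w s (E : set X) : (1 < p)%R -> Ap_pair p a w s ->
  measurable E ->
  mu E `^ p <= \int[mu]_(y in E) (w y)%:E *
               (\int[mu]_(y in E) (s y)%:E) `^ (p - 1).
Proof.
move=> p1 wA mE; have p0 : (0 < p)%R by apply: lt_trans p1.
have s0 : (0 < p - 1)%R by rewrite subr_gt0.
have w0 := ap_w0 wA.
have mpow r : measurable_fun setT (fun x => w x `^ r)%R.
  exact: (measurableT_comp (measurable_powR r) (ap_mw wA)).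
have := @ge0_hoelder _ _ _ mu E (fun x => w x `^ p^-1)%R
  (fun x => w x `^ (- p^-1))%R p (p / (p - 1))%R mE (mpow _) (mpow _)
  (fun=> powR_ge0 _ _) (fun=> powR_ge0 _ _) p0 (divr_gt0 p0 s0).
have -> : (p^-1 + (p / (p - 1))^-1 = 1)%R.
  by rewrite invf_div; field; rewrite gt_eqF.
move=> /(_ erefl) /=.
under eq_integral => x _ do
  rewrite powRN divff ?(gt_eqF (powR_gt0 _ (w0 _)))//.
under [in leRHS]eq_integral => x _ do
  rewrite -powRrM mulVf ?gt_eqF// powRr1 ?(ltW (w0 x))//.
rewrite integral_cst// mul1e.
have -> : \int[mu]_(x in E) ((w x `^ (- p^-1)) `^ (p / (p - 1)))%:E =
    \int[mu]_(x in E) (s x)%:E.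
  apply: eq_integral => x _; rewrite (ap_sE wA) -powRrM; congr (_ `^ _)%:E.
  by field; rewrite !gt_eqF.
move=> /(lee_poweR (ltW p0) (measure_ge0 _ _)).
rewrite poweRM ?poweR_ge0// -!poweRrM mulVf ?gt_eqF// poweRe1; last first.
  by apply: integral_ge0 => x _; rewrite lee_fin ltW.
by rewrite invf_div divfK ?gt_eqF.
Qed.

End muckenhoupt.

(** * Weighted bound for the maximal operator, by Lerner's method *)

Section muckenhoupt_theorem.
Local Open Scope ereal_scope.
Context (R : realType) d (X : measurableType d) (rho : X -> X -> R).
Context (K : R) (rqm : regular_quasi_metric rho K).
Context (mu : {measure set X -> \bar R}) (D : R) (dbl : doubling rho mu D).
Implicit Types (p a : R) (w s : X -> R).

Let mball x r : measurable (qball rho x r).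
Proof. exact: rqm_measurable rqm _ _. Qed.
Hint Resolve mball : core.

Definition Ap_doubling_const p a : R := Num.max 1%R (a * D `^ p)%R.

Lemma dual_gt1 p : (1 < p)%R -> (1 < p / (p - 1))%R.
Proof. by move=> p1; rewrite ltr_pdivlMr ?subr_gt0// mul1r gtrBl. Qed.

Lemma measurable_div_weight (v : X -> R) (f : X -> \bar R) :
  measurable_fun setT v -> (forall x, 0 < v x)%R -> measurable_fun setT f ->
  measurable_fun setT (fun x => f x * (v x)^-1%:E).
Proof.
move=> mv v0 mf; apply: emeasurable_funM => //; apply/measurable_EFinP.
rewrite (_ : (fun x => _) = (fun x => v x `^ (-1))%R).
  exact: (measurableT_comp (measurable_powR _)).
by apply/funext => x; rewrite powR_inv1// ltW.
Qed.

(** The [A_p] inequality on one ball, moved to the reals and cleared of denominators. The integral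
    of [s] is finite because the dual pair is again of this kind. *)
Lemma Ap_pair_EFin p a w s x r : (1 < p)%R -> Ap_pair rho mu p a w s ->
  (0 < r)%R ->
  exists m W S : R, [/\ (0 < m)%R, (0 < W)%R & (0 < S)%R] /\
    [/\ mu (qball rho x r) = m%:E,
        \int[mu]_(y in qball rho x r) (w y)%:E = W%:E,
        \int[mu]_(y in qball rho x r) (s y)%:E = S%:E &
        (W * S `^ (p - 1) <= a * m `^ p)%R].
Proof.
move=> p1 wA r0; have wA' := Ap_pair_dual rqm dbl p1 wA.
have := ap_le wA x r0; rewrite !(avgE rqm dbl)//=.
have := dbl_gt0 dbl x r0; have := dbl_lty dbl x r0.
have := Ap_pair_lty rqm dbl x wA r0; have := Ap_pair_lty rqm dbl x wA' r0.
have := Ap_pair_weight_gt0 rqm dbl x wA r0.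
have := Ap_pair_weight_gt0 rqm dbl x wA' r0.
case: (\int[mu]_(y in _) (s y)%:E) => [S| |]//.
case: (\int[mu]_(y in _) (w y)%:E) => [W| |]//.
case: (mu _) => [m| |]//; rewrite !lte_fin => S0 W0 _ _ _ m0.
rewrite /= => le_a; rewrite lee_fin in le_a.
exists m, W, S; split=> //; split=> //.
have mp : (m * m `^ (p - 1) = m `^ p)%R.
  by rewrite mulr_powRB1 ?(lt_trans ltr01)// ltW.
have mV : (m^-1 `^ (p - 1) = (m `^ (p - 1))^-1)%R.
  by rewrite -(powR_inv1 (ltW m0)) powRAC powR_inv1 ?powR_ge0.
have : (m^-1 * W * (m^-1 * S) `^ (p - 1) * m `^ p = W * S `^ (p - 1))%R.
  rewrite powRM ?invr_ge0 ?(ltW m0) ?(ltW S0)// -mp mV.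
  by field; rewrite !gt_eqF ?powR_gt0.
by move=> <-; rewrite ler_wpM2r ?powR_ge0.
Qed.

(** With [B] a ball and [2B] its double, [w(2B) s(2B)^(p-1) <= a mu(2B)^p <= a D^p mu(B)^p <= a D^p
    w(B) s(B)^(p-1)]; since [s(B) <= s(2B)], the factor [s(2B)^(p-1)] cancels. *)
Lemma Ap_pair_doubling p a w s (nu : {measure set X -> \bar R}) :
  (1 < p)%R -> Ap_pair rho mu p a w s ->
  is_density mu w nu ->
  doubling rho nu (Ap_doubling_const p a).
Proof.
move=> p1 wA nuw; have nuE := is_densityE nuw; split.
- by rewrite le_max lexx.
- by move=> x r r0; rewrite nuE//; exact: (Ap_pair_weight_gt0 rqm dbl x wA r0).
- by move=> x r r0; rewrite nuE//; exact: (Ap_pair_lty rqm dbl x wA r0).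
move=> x r r0; rewrite !nuE//.
have r20 : (0 < 2 * r)%R by rewrite mulr_gt0.
have p0 : (0 < p)%R by apply: lt_trans p1.
have [m1 [W1 [S1 [[m10 W10 S10] [m1E W1E S1E le1]]]]] := Ap_pair_EFin x p1 wA
  r0.
have [m2 [W2 [S2 [[m20 W20 S20] [m2E W2E S2E le2]]]]] := Ap_pair_EFin x p1 wA
  r20.
have := Ap_pair_measure_le p1 wA (mball x r).
have := dbl_le dbl x r0.
rewrite W1E W2E S1E m1E m2E !poweR_EFin -!EFinM !lee_fin => m21 m1p.
have S12 : (S1 <= S2)%R.
  rewrite -lee_fin -S1E -S2E; apply: ge0_subset_integral => //.
  - by apply: measurable_funTS; exact/measurable_EFinP/(ap_ms wA).
  - by move=> y _; rewrite lee_fin ltW// (ap_s0 wA).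
  - by apply: sub_qball; rewrite ler_peMl ?ltW// ltr1n.
have D0 : (0 <= D)%R by apply: le_trans (dbl_ge1 dbl).
have S2p : (0 < S2 `^ (p - 1))%R by rewrite powR_gt0.
have a0 : (0 <= a)%R.
  rewrite -(@pmulr_lge0 _ (m2 `^ p)) ?powR_gt0//; apply: le_trans le2.
  by rewrite mulr_ge0// ltW.
apply: (@le_trans _ _ (a * D `^ p * W1)%R); last first.
  by rewrite ler_wpM2r ?(ltW W10)// le_max lexx orbT.
rewrite -(ler_pM2r S2p); apply: (le_trans le2).
rewrite -!mulrA ler_wpM2l//.
apply: (@le_trans _ _ (D `^ p * m1 `^ p)%R).
  by rewrite -powRM ?(ltW m10)// ge0_ler_powR ?nnegrE ?(ltW p0) ?(ltW m20)
    ?mulr_ge0 ?(ltW m10).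
rewrite ler_wpM2l ?powR_ge0//; apply: (le_trans m1p).
rewrite ler_wpM2l ?(ltW W10)// ge0_ler_powR ?nnegrE ?(ltW S10) ?(ltW S20)//.
by rewrite subr_ge0 ltW.
Qed.

Local Notation M := (maximal_function rho mu).

(** [a^p'] comes from raising the pointwise bound to the power [p]; the other factors bound the
    maximal operators of [w dmu] on exponent [p'] and of [s dmu] on exponent [p]. *)
Definition muckenhoupt_const p a : R :=
  let p' := (p / (p - 1))%R in
  (a `^ p' * (strong_const K (Ap_doubling_const p a) p' *
              strong_const K (Ap_doubling_const p' (a `^ (p - 1)^-1)) p))%R.

(** On a ball [B], the [mu]-average of [f] is [s(B)/mu(B)] times the [s]-average of [f/s]. After
    raising to the power [p-1] and bounding the latter through [w(B)/mu(B)], the weights form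
    exactly the [A_p] product. *)
Lemma maximal_function_le p a w s f (nw ns : {measure set X -> \bar R}) :
  (1 < p)%R -> Ap_pair rho mu p a w s ->
  is_density mu w nw -> is_density mu s ns ->
  measurable_fun setT f -> (forall x, 0 <= f x) ->
  forall x, M f x <= (a%:E * maximal_function rho nw
    (fun y => maximal_function rho ns (fun z => f z * (s z)^-1%:E) y `^ (p - 1)
      * (w y)^-1%:E) x) `^ (p - 1)^-1.
Proof.
move=> p1 wA nwd nsd mf f0 x.
have dw := Ap_pair_doubling p1 wA nwd.
have ds := Ap_pair_doubling (dual_gt1 p1) (Ap_pair_dual rqm dbl p1 wA) nsd.
have w0 := ap_w0 wA; have s0 := ap_s0 wA.
have q0 : (0 < p - 1)%R by rewrite subr_gt0.
set fs := fun z => f z * (s z)^-1%:E.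
set Ms := maximal_function rho ns fs.
set G := fun y => Ms y `^ (p - 1) * (w y)^-1%:E.
have mfs : measurable_fun setT fs := measurable_div_weight (ap_ms wA) s0 mf.
have fs0 z : 0 <= fs z by rewrite mule_ge0// lee_fin invr_ge0 ltW.
have mMs : measurable_fun setT Ms by exact: measurable_maximal_function rqm _ _.
have Ms0 z : 0 <= Ms z by exact: (maximal_function_ge0 rqm).
have mMsp : measurable_fun setT (fun y => Ms y `^ (p - 1)).
  exact: (measurableT_comp (measurable_poweR _)).
have mG : measurable_fun setT G := measurable_div_weight (ap_mw wA) w0 mMsp.
have G0 z : 0 <= G z by rewrite mule_ge0 ?poweR_ge0// lee_fin invr_ge0 ltW.
apply: ge_ereal_sup => _ [c [r [r0 cx ->]]].
have [m [W [S [[m0 W0 S0] [mE WE SE le_a]]]]] := Ap_pair_EFin c p1 wA r0.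
set B := qball rho c r in mE WE SE *.
have mB : measurable B by exact: mball.
have avgm h : avg mu B h = m^-1%:E * \int[mu]_(y in B) h y.
  by rewrite /avg mE inver gt_eqF.
have avgW h : avg nw B h = W^-1%:E * \int[nw]_(y in B) h y.
  by rewrite /avg (is_densityE nwd)// WE inver gt_eqF.
have avgS h : avg ns B h = S^-1%:E * \int[ns]_(y in B) h y.
  by rewrite /avg (is_densityE nsd)// SE inver gt_eqF.
have If : \int[ns]_(y in B) fs y = \int[mu]_(y in B) f y.
  rewrite nsd//; apply: eq_integral => y _.
  by rewrite /fs -muleA -EFinM mulVf ?gt_eqF// mule1.
set Mw := maximal_function rho nw G x.
have Mw0 : 0 <= Mw by exact: (maximal_function_ge0 rqm).
set J := avg ns B fs `^ (p - 1).
have avg0 : 0 <= avg ns B fs.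
  by rewrite avgS mule_ge0 ?integral_ge0// lee_fin invr_ge0 ltW.
(* [Ms] dominates the [s]-average at every point of [B], so the constant [J] may be integrated over
   [B] under [Ms^(p-1) dmu = G w dmu]. *)
have JW : J * m%:E <= W%:E * Mw.
  apply: (@le_trans _ _ (\int[nw]_(y in B) G y)).
    rewrite nwd// -mE -integral_cst//; apply: ge0_le_integral => //.
    - by move=> y _; exact: poweR_ge0.
    - apply: emeasurable_funM; first exact: measurable_funTS.
      by apply: measurable_funTS; exact/measurable_EFinP/(ap_mw wA).
    - move=> y By; rewrite /G -muleA -EFinM mulVf ?gt_eqF// mule1.
      apply: lee_poweR => //; first exact: ltW.
      exact: avg_maximal_function.
  by rewrite -lee_pdivrMl// -avgW; exact: avg_maximal_function.
have {}JW : J <= m^-1%:E * (W%:E * Mw) by rewrite lee_pdivlMl// muleC.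
have avgf0 : 0 <= avg mu B f.
  by rewrite avgm mule_ge0 ?integral_ge0// lee_fin invr_ge0 ltW.
rewrite -(@poweRK _ (avg mu B f) (p - 1)) ?gt_eqF//.
apply: lee_poweR; rewrite ?invr_ge0 ?(ltW q0) ?poweR_ge0//.
have -> : avg mu B f = (m^-1 * S)%:E * avg ns B fs.
  by rewrite avgm avgS If muleA -EFinM mulfK// gt_eqF.
have mS0 : (0 <= m^-1 * S)%R by rewrite mulr_ge0 ?invr_ge0 ?ltW.
rewrite poweRM ?lee_fin// -/J poweR_EFin.
apply: (@le_trans _ _ (((m^-1 * S) `^ (p - 1))%:E * (m^-1%:E * (W%:E * Mw)))).
  by rewrite lee_wpmul2l// lee_fin powR_ge0.
rewrite !muleA -!EFinM lee_wpmul2r// lee_fin.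
have mV : (m^-1 `^ (p - 1) = (m `^ (p - 1))^-1)%R.
  by rewrite -(powR_inv1 (ltW m0)) powRAC powR_inv1 ?powR_ge0.
rewrite powRM ?invr_ge0 ?(ltW m0) ?(ltW S0)// mV.
move: le_a; rewrite -(mulr_powRB1 (ltW m0) (lt_trans ltr01 p1)).
rewrite -ler_pdivrMr ?mulr_gt0 ?powR_gt0// => /(le_trans _); apply.
rewrite le_eqVlt; apply/orP; left; apply/eqP; field.
by rewrite !gt_eqF ?powR_gt0.
Qed.

Lemma muckenhoupt p a w s f : (1 < p)%R -> Ap_pair rho mu p a w s ->
  measurable_fun setT f -> (forall x, 0 <= f x) ->
  \int[mu]_x (M f x `^ p * (w x)%:E) <=
  (muckenhoupt_const p a)%:E * \int[mu]_x (f x `^ p * (w x)%:E).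
Proof.
move=> p1 wA mf f0.
have [nw nwd] := density_exists mu (ap_mw wA) (fun x => ltW (ap_w0 wA x)).
have [ns nsd] := density_exists mu (ap_ms wA) (fun x => ltW (ap_s0 wA x)).
have dw := Ap_pair_doubling p1 wA nwd.
have p'1 := dual_gt1 p1.
have ds := Ap_pair_doubling p'1 (Ap_pair_dual rqm dbl p1 wA) nsd.
set p' := (p / (p - 1))%R in p'1 ds *.
have w0 := ap_w0 wA; have s0 := ap_s0 wA.
have q0 : (0 < p - 1)%R by rewrite subr_gt0.
have p0 : (0 < p)%R by apply: lt_trans p1.
have p'0 : (0 < p')%R by apply: lt_trans p'1.
set fs := fun z => f z * (s z)^-1%:E.
set Ms := maximal_function rho ns fs.
set G := fun y => Ms y `^ (p - 1) * (w y)^-1%:E.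
have mfs : measurable_fun setT fs := measurable_div_weight (ap_ms wA) s0 mf.
have fs0 z : 0 <= fs z by rewrite mule_ge0// lee_fin invr_ge0 ltW.
have mMs : measurable_fun setT Ms by exact: measurable_maximal_function rqm _ _.
have Ms0 z : 0 <= Ms z by exact: (maximal_function_ge0 rqm).
have mMsp : measurable_fun setT (fun y => Ms y `^ (p - 1)).
  exact: (measurableT_comp (measurable_poweR _)).
have mG : measurable_fun setT G := measurable_div_weight (ap_mw wA) w0 mMsp.
have G0 z : 0 <= G z by rewrite mule_ge0 ?poweR_ge0// lee_fin invr_ge0 ltW.
have mM : measurable_fun setT (M f) by exact: measurable_maximal_function rqm
  _ _.
have mMp : measurable_fun setT (fun y => M f y `^ p).
  exact: (measurableT_comp (measurable_poweR _)).
set Mw := maximal_function rho nw G.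
have mMw : measurable_fun setT Mw by exact: measurable_maximal_function rqm _ _.
have Mw0 z : 0 <= Mw z by exact: (maximal_function_ge0 rqm).
have mpow (h : X -> \bar R) r : measurable_fun setT h ->
  measurable_fun setT (fun y => h y `^ r).
  by move=> mh; exact: (measurableT_comp (measurable_poweR _)).
(* The sign of [a] is read off from the inequality on some ball, so a point is needed. *)
have [[x0 _]|noX] := pselect (exists x : X, True); last first.
  have T0 : [set: X] = set0 by rewrite -subset0 => x _; apply: noX; exists x.
  by rewrite T0 !integral_set0 mule0.
have a0 : (0 <= a)%R.
  have [m [W [S [[m0 W0 S0] [_ _ _ le_a]]]]] := Ap_pair_EFin x0 p1 wA ltr01.
  rewrite -(@pmulr_lge0 _ (m `^ p)) ?powR_gt0//; apply: le_trans le_a.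
  by rewrite mulr_ge0 ?powR_ge0// ltW.
rewrite -nwd//; last by move=> x; exact: poweR_ge0.
apply: (@le_trans _ _ (\int[nw]_x ((a `^ p')%:E * Mw x `^ p'))).
  apply: ge0_le_integral => //.
  - by move=> x _; exact: poweR_ge0.
  - by apply: measurable_funeM; exact: mpow.
  - move=> x _; have := maximal_function_le p1 wA nwd nsd mf f0 x.
    move=> /(lee_poweR (ltW p0) (maximal_function_ge0 rqm _ _ f0)).
    rewrite -poweRrM mulrC -/p' poweRM ?lee_fin//.
rewrite ge0_integralZl ?lee_fin ?powR_ge0//; last 2 first.
- exact: mpow.
- by move=> x _; exact: poweR_ge0.
rewrite /muckenhoupt_const -/p' EFinM -muleA lee_wpmul2l ?lee_fin ?powR_ge0//.
apply: le_trans (strong_type rqm dw p'1 mG G0) _.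
rewrite [X in _ <= X * _]EFinM -muleA lee_wpmul2l ?lee_fin
  ?(strong_const_ge0 _ dw)//.
(* Since [(p-1) p' = p] and [1 - p' = -1/(p-1)], one has [G^p' w = Ms^p w^(1-p') = Ms^p s]: the
   output of the second operator is measured in its own measure. *)
have -> : \int[nw]_x G x `^ p' = \int[ns]_x Ms x `^ p.
  rewrite nwd//; [|exact: mpow|by move=> x; exact: poweR_ge0].
  rewrite nsd//; [|exact: mpow|by move=> x; exact: poweR_ge0].
  apply: eq_integral => x _; rewrite /G poweRM ?poweR_ge0//; last first.
    by rewrite lee_fin invr_ge0 ltW.
  rewrite -poweRrM (_ : (p - 1) * p' = p)%R; last first.
    by rewrite /p'; field; rewrite gt_eqF.
  rewrite -muleA; congr (_ * _); rewrite poweR_EFin -EFinM; congr (_%:E).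
  rewrite (ap_sE wA) -(powR_inv1 (ltW (w0 x))) -powRrM.
  rewrite -{2}(powRr1 (ltW (w0 x))) -powRD; last by rewrite (gt_eqF (w0 x))
    implybT.
  by congr (_ `^ _)%R; rewrite /p'; field; rewrite gt_eqF.
apply: le_trans (strong_type rqm ds p1 mfs fs0) _.
rewrite le_eqVlt; apply/orP; left; apply/eqP; congr (_ * _).
(* Here [(f/s)^p s = f^p s^(1-p) = f^p w]. *)
rewrite nsd//; [|exact: mpow|by move=> x; exact: poweR_ge0].
apply: eq_integral => x _; rewrite /fs poweRM//; last first.
  by rewrite lee_fin invr_ge0 ltW.
rewrite -muleA; congr (_ * _); rewrite poweR_EFin -EFinM; congr (_%:E).
rewrite -(powR_inv1 (ltW (s0 x))) -powRrM.
rewrite -{2}(powRr1 (ltW (s0 x))) -powRD; last by rewrite (gt_eqF (s0 x))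
  implybT.
rewrite (ap_sE wA) -powRrM -[RHS](powRr1 (ltW (w0 x))).
by congr (_ `^ _)%R; field; rewrite gt_eqF.
Qed.

End muckenhoupt_theorem.

(** * Rubio de Francia's algorithm *)

(** Convexity of [t^p] at a midpoint. The constant is written [2^p 2^-1] because two such halves are
    added up to [2^p] in [normT]. *)
Lemma poweRD_le (R : realType) (u v : \bar R) (p : R) : 1 <= p ->
  (0 <= u -> 0 <= v ->
   (u + v) `^ p <= (2 `^ p * 2^-1)%R%:E * (u `^ p + v `^ p))%E.
Proof.
move=> p1; have p0 : 0 < p by exact: lt_le_trans p1.
have c0 : 0 < 2 `^ p * 2^-1 :> R by rewrite mulr_gt0 ?powR_gt0 ?invr_gt0.
have NNy (x : \bar R) : (0 <= x)%E -> x != -oo%E.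
  by move=> x0; rewrite gt_eqF// (lt_le_trans _ x0)// ltNyr.
move=> u0 v0; have [uy|uNy] := eqVneq u +oo%E.
  by rewrite uy poweRyr ?gt_eqF// !addye ?NNy ?poweR_ge0// gt0_muley ?leey
    ?lte_fin.
have [vy|vNy] := eqVneq v +oo%E.
  by rewrite vy poweRyr ?gt_eqF// !addey ?NNy ?poweR_ge0// gt0_muley ?leey
    ?lte_fin.
case: u u0 uNy => [u| |]// + _; case: v v0 vNy => [v| |]// + _.
rewrite !lee_fin => v0 u0; rewrite -mulrA.
have -> : u + v = 2 * (2^-1 * u + 2^-1 * v) by field.
rewrite powRM ?addr_ge0 ?mulr_ge0 ?invr_ge0// ler_pM2l ?powR_gt0//.
rewrite mulrDr {2 4}(_ : 2^-1 = 1 - 2^-1); last by field.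
by apply: (convex_powR p1 (Itv01 _ _)) => //=;
  rewrite ?inE/= ?in_itv/= ?u0 ?v0// ?invr_ge0// invf_le1 ?ler1n.
Qed.

Section integral_sup.
Local Open Scope ereal_scope.
Context d (T : measurableType d) (R : realType)
  (mu : {measure set T -> \bar R}).
Context (u : nat -> T -> \bar R).
Hypotheses (mu_ : forall n, measurable_fun setT (u n))
  (u0 : forall n x, 0 <= u n x)
  (ndu : forall n x, u n x <= u n.+1 x).
Local Notation U := (fun x => ereal_sup (range (u ^~ x))).

Let cvg_sup x : u ^~ x @ \oo --> U x.
Proof.
by apply: ereal_nondecreasing_cvgn; apply/nondecreasing_seqP => n; exact: ndu.
Qed.

Lemma measurable_sup : measurable_fun setT U.
Proof. by apply: emeasurable_fun_cvg mu_ _ => x _; exact: cvg_sup. Qed.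

Lemma integral_sup_le (D : set T) (c : \bar R) : measurable D ->
  (forall n, \int[mu]_(x in D) u n x <= c) -> \int[mu]_(x in D) U x <= c.
Proof.
move=> mD uc.
have -> : \int[mu]_(x in D) U x = limn (fun n => \int[mu]_(x in D) u n x).
  rewrite -monotone_convergence//.
  - by apply: eq_integral => x _; apply/esym/cvg_lim => //; exact: cvg_sup.
  - by move=> n; exact: measurable_funTS.
  - by move=> x _; apply/nondecreasing_seqP => n; exact: ndu.
apply: lime_le; last by apply: nearW => n; exact: uc.
apply: ereal_nondecreasing_is_cvgn; apply/nondecreasing_seqP => n.
apply: ge0_le_integral => //; exact: measurable_funTS.
Qed.

End integral_sup.

Section A1_majorant.
Local Open Scope ereal_scope.
Context (R : realType) d (X : measurableType d) (rho : X -> X -> R).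
Context (K : R) (rqm : regular_quasi_metric rho K).
Context (mu : {measure set X -> \bar R}) (D : R) (dbl : doubling rho mu D).
Local Notation M := (maximal_function rho mu).
Context (p a : R) (w s : X -> R) (p1 : (1 < p)%R).
Context (wA : Ap_pair rho mu p a w s).

Let mball x r : measurable (qball rho x r).
Proof. exact: rqm_measurable rqm _ _. Qed.
Hint Resolve mball : core.

(** The maximum with 1 keeps the norm positive, so that [rubio_iter] can divide by it. *)
Definition maximal_norm : R := Num.max 1%R (muckenhoupt_const K D p a) `^ p^-1.

Local Notation C := maximal_norm.

Let p0 : (0 < p)%R. Proof. exact: lt_trans ltr01 p1. Qed.
Let w0 x : (0 < w x)%R. Proof. exact: (ap_w0 wA). Qed.

Let C0 : (0 < C)%R. Proof. by rewrite powR_gt0// lt_max ltr01. Qed.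

Let mwe : measurable_fun setT (fun x => (w x)%:E).
Proof. by apply/measurable_EFinP; exact: ap_mw wA. Qed.

Let mpow (h : X -> \bar R) : measurable_fun setT h ->
  measurable_fun setT (fun x => h x `^ p * (w x)%:E).
Proof.
move=> mh; apply: emeasurable_funM => //.
exact: (measurableT_comp (measurable_poweR _)).
Qed.

Let pow_ge0 (h : X -> \bar R) x : 0 <= h x `^ p * (w x)%:E.
Proof. by rewrite mule_ge0 ?poweR_ge0// lee_fin ltW. Qed.

Lemma maximal_norm_le f : measurable_fun setT f -> (forall x, 0 <= f x) ->
  \int[mu]_x (M f x `^ p * (w x)%:E) <=
  (C `^ p)%:E * \int[mu]_x (f x `^ p * (w x)%:E).
Proof.
move=> mf f0; apply: le_trans (muckenhoupt rqm dbl p1 wA mf f0) _.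
rewrite lee_wpmul2r//; first exact: integral_ge0.
rewrite lee_fin -powRrM mulVf ?gt_eqF// powRr1 ?le_max ?lexx ?orbT//.
by rewrite ler01.
Qed.

Context (h : X -> \bar R) (mh : measurable_fun setT h)
  (h0 : forall x, 0 <= h x).

(* The iterates stand for the partial sums of [sum_k M^k h / (2 C)^k]: as [M] is
   only sublinear, it is the recursion that gives [M T <= 2 C T] in the limit. *)
Fixpoint rubio_iter n (x : X) : \bar R :=
  if n is n'.+1 then h x + ((2 * C)^-1)%:E * M (rubio_iter n') x else h x.

Local Notation T_ := rubio_iter.

Let C2 : (0 <= (2 * C)^-1)%R.
Proof. by rewrite invr_ge0 mulr_ge0// ltW. Qed.

Let mT n : measurable_fun setT (T_ n).
Proof.
elim: n => //= n ih; apply: emeasurable_funD => //.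
by apply: measurable_funeM; exact: measurable_maximal_function rqm _ _.
Qed.

Let T0 n x : 0 <= T_ n x.
Proof.
elim: n x => //= n ih x; rewrite adde_ge0// mule_ge0 ?lee_fin//.
exact: (maximal_function_ge0 rqm).
Qed.

Let ndT n x : T_ n x <= T_ n.+1 x.
Proof.
elim: n x => [|n ih] x.
  by rewrite leeDl// mule_ge0 ?lee_fin//; exact: (maximal_function_ge0 rqm).
rewrite leeD2l// lee_wpmul2l ?lee_fin//.
exact: (le_maximal_function rqm mu (mT n) (mT n.+1) (T0 n) ih x).
Qed.

(** The bound reproduces itself: convexity gives half of [2^p] to [h], while the iterate contributes
    [2^(p-1) (2C)^(-p) C^p 2^p], which is the other half. *)
Let normT n : \int[mu]_x (T_ n x `^ p * (w x)%:E) <=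
  (2 `^ p)%:E * \int[mu]_x (h x `^ p * (w x)%:E).
Proof.
have I0 : 0 <= \int[mu]_x (h x `^ p * (w x)%:E) by exact: integral_ge0.
have e2 : (1 <= 2 `^ p :> R)%R.
  by rewrite -[leLHS](powRr0 2) ler_powR ?ler1n// ltW.
elim: n => [|n ih]; first by rewrite lee_pemull.
set Mn := M (T_ n).
have mMn : measurable_fun setT Mn by exact: measurable_maximal_function rqm _ _.
have Mn0 x : 0 <= Mn x by exact: (maximal_function_ge0 rqm).
have c0 : (0 <= 2 `^ p * 2^-1 :> R)%R by rewrite mulr_ge0 ?powR_ge0.
have pw x : T_ n.+1 x `^ p * (w x)%:E <= (2 `^ p * 2^-1)%:E *
    (h x `^ p * (w x)%:E) +
    (2^-1 * (C `^ p)^-1)%:E * (Mn x `^ p * (w x)%:E).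
  rewrite /=; set v := (_ * M _ x).
  have v0 : 0 <= v by rewrite mule_ge0// lee_fin.
  apply: le_trans (lee_wpmul2r _ (poweRD_le (ltW p1) (h0 x) v0)) _.
    by rewrite lee_fin ltW.
  rewrite -muleA ge0_muleDl ?poweR_ge0// ge0_muleDr ?mule_ge0 ?poweR_ge0
    ?lee_fin ?(ltW (w0 x))//.
  rewrite leeD2l// /v poweRM ?lee_fin// poweR_EFin !muleA -EFinM.
  rewrite le_eqVlt; apply/orP; left; apply/eqP; congr (_%:E * _ * _).
  rewrite -(powR_inv1 (_ : 0 <= 2 * C))%R ?mulr_ge0 ?(ltW C0)//.
  rewrite -powRrM mulN1r powRN powRM ?(ltW C0)//.
  by field; apply/andP; split; rewrite gt_eqF// powR_gt0.
apply: (@le_trans _ _ (\int[mu]_x ((2 `^ p * 2^-1)%:E *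
    (h x `^ p * (w x)%:E) +
    (2^-1 * (C `^ p)^-1)%:E * (Mn x `^ p * (w x)%:E)))).
  apply: ge0_le_integral => //; first exact: mpow.
  by apply: emeasurable_funD; apply: measurable_funeM; exact: mpow.
have k0 : (0 <= 2^-1 * (C `^ p)^-1)%R.
  by rewrite mulr_ge0 ?invr_ge0 ?powR_ge0.
rewrite ge0_integralD//; last 4 first.
- by move=> x _; rewrite mule_ge0 ?lee_fin.
- by apply: measurable_funeM; exact: mpow.
- by move=> x _; rewrite mule_ge0 ?lee_fin.
- by apply: measurable_funeM; exact: mpow.
rewrite !ge0_integralZl ?lee_fin//; [|exact: mpow|exact: mpow].
have -> : (2 `^ p)%:E = (2 `^ p * 2^-1)%:E + (2^-1 * 2 `^ p)%:E :> \bar R.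
  by rewrite -EFinD; congr (_%:E); field.
rewrite ge0_muleDl ?lee_fin ?mulr_ge0 ?powR_ge0// leeD2l//.
apply: le_trans (lee_wpmul2l _ (maximal_norm_le (mT n) (T0 n))) _.
  by rewrite lee_fin.
have kC : (2^-1 * (C `^ p)^-1)%:E * (C `^ p)%:E = 2^-1%:E :> \bar R.
  by rewrite -EFinM divfK// gt_eqF// powR_gt0.
by rewrite muleA kC [(2^-1 * _)%:E]EFinM -muleA lee_wpmul2l.
Qed.

Lemma A1_majorant : exists T : X -> \bar R,
  [/\ measurable_fun setT T,
      forall x, h x <= T x,
      forall c r x, (0 < r)%R -> qball rho c r x ->
        avg mu (qball rho c r) T <= (2 * C)%:E * T x &
      \int[mu]_x (T x `^ p * (w x)%:E) <=
        (2 `^ p)%:E * \int[mu]_x (h x `^ p * (w x)%:E)].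
Proof.
pose T x := ereal_sup (range (T_ ^~ x)).
have leT n x : T_ n x <= T x by apply: ereal_sup_ubound; exists n.
exists T; split.
- exact: measurable_sup.
- by move=> x; exact: (leT 0%N).
- move=> c r x r0 cx; rewrite (avg_le rqm dbl)//.
  (* By monotone convergence it suffices to bound each [T_ n]: its average is at most [M (T_ n) x],
     which is at most [2 C T_ n.+1 x] by the recursion. *)
  apply: integral_sup_le => // n.
  rewrite -(avg_le rqm dbl)//; apply: le_trans
    (avg_maximal_function _ _ r0 cx) _.
  rewrite -lee_pdivrMl ?mulr_gt0//; apply: le_trans (leT n.+1 x).
  by rewrite /= leeDr.
apply: (@le_trans _ _ (\int[mu]_x ereal_sup (range
    (fun n => T_ n x `^ p * (w x)%:E)))); last first.
  apply: integral_sup_le => // [n|n x]; first exact: mpow.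
  by rewrite lee_wpmul2r ?lee_fin ?(ltW (w0 x))// lee_poweR ?(ltW p0).
apply: ge0_le_integral => //.
- by apply: mpow; exact: measurable_sup.
- apply: (@measurable_sup _ _ _ (fun n x => T_ n x `^ p * (w x)%:E)).
    by move=> n; exact: mpow.
  by move=> n x; rewrite lee_wpmul2r ?lee_fin ?(ltW (w0 x))// lee_poweR
    ?(ltW p0).
move=> x _; set L := ereal_sup _.
have Ln n : T_ n x `^ p * (w x)%:E <= L by apply: ereal_sup_ubound; exists n.
rewrite -lee_pdivlMr//.
have Lw0 : 0 <= L * (w x)^-1%:E.
  by rewrite mule_ge0 ?lee_fin ?invr_ge0 ?(ltW (w0 x))// (le_trans _ (Ln 0%N)).
(* A power of a supremum is handled by taking roots: every [T_ n x] is below the [p]-th root of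
   [L / w x], hence so is [T x]. *)
have : T x <= (L * (w x)^-1%:E) `^ p^-1.
  apply: ge_ereal_sup => _ [n _ <-].
  rewrite -(@poweRK _ (T_ n x) p) ?gt_eqF// lee_poweR ?invr_ge0 ?(ltW p0)
    ?poweR_ge0//.
  by rewrite lee_pdivlMr.
move=> /(lee_poweR (ltW p0) (le_trans (T0 0%N x) (leT _ _))).
by rewrite -poweRrM mulVf ?gt_eqF// poweRe1.
Qed.

End A1_majorant.

Lemma ae_exists_in d (T : measurableType d) (R : realType)
    (mu : {measure set T -> \bar R}) (P : T -> Prop) (B : set T) :
  {ae mu, forall x, P x} -> measurable B -> (0 < mu B)%E ->
  exists2 x, B x & P x.
Proof.
move=> [N [mN N0 PN]] mB B0; apply: contrapT => nex.
have : (mu B <= mu N)%E.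
  apply: le_measure; rewrite ?inE// => x Bx; apply: PN => /= Px.
  by apply: nex; exists x.
by rewrite N0 leNgt B0.
Qed.

(** * A_1 weights and the weight built from two of them *)

Section A1_weight.
Local Open Scope ereal_scope.
Context (R : realType) d (X : measurableType d) (rho : X -> X -> R).
Context (K : R) (rqm : regular_quasi_metric rho K).
Context (mu : {measure set X -> \bar R}) (D : R) (dbl : doubling rho mu D).

Let mball x r : measurable (qball rho x r).
Proof. exact: rqm_measurable rqm _ _. Qed.
Hint Resolve mball : core.

Lemma bigcup_qball x : \bigcup_n qball rho x n.+1%:R = setT.
Proof.
apply/seteqP; split=> // y _; exists (Num.bound (rho x y)) => //.
rewrite /qball/=; apply: lt_trans (archi_boundP (qm_ge0 (rqm_qm rqm) _ _)) _.
by rewrite ltr_nat.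
Qed.

Lemma integral_qball_le x (f : X -> \bar R) (c : \bar R) :
  measurable_fun setT f -> (forall y, 0 <= f y) ->
  (forall n, \int[mu]_(y in qball rho x n.+1%:R) f y <= c) ->
  \int[mu]_y f y <= c.
Proof.
move=> mf f0 fc; rewrite -(bigcup_qball x).
have cB : \int[mu]_(y in qball rho x n.+1%:R) f y @[n --> \oo] -->
    \int[mu]_(y in \bigcup_n qball rho x n.+1%:R) f y.
  apply: ge0_nondecreasing_set_cvg_integral => //.
  - by move=> m n mn; apply/subsetPset/sub_qball; rewrite ler_nat.
  - by move=> n; exact: measurable_funTS.
rewrite -(cvg_lim _ cB)//; apply: lime_le; first exact: cvgP cB.
exact: nearW.
Qed.

(** The witness [A] records that the average is finite and positive. The bound is only almost
    everywhere because [T] is a real-valued version of an extended majorant. *)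
Record A1_bound (L : R) (T : X -> R) : Prop := A1Bound {
  a1_measurable : measurable_fun setT T ;
  a1_gt0 : forall x, (0 < T x)%R ;
  a1_le : forall c r, (0 < r)%R -> exists A : R, [/\ (0 < A)%R,
    avg mu (qball rho c r) (EFin \o T) = A%:E &
    {ae mu, forall x, qball rho c r x -> (A <= L * T x)%R}] }.

Lemma A1_weight (p a : R) (w s h : X -> R) : (1 < p)%R ->
  Ap_pair rho mu p a w s ->
  measurable_fun setT h -> (forall x, 0 <= h x)%R ->
  0 < \int[mu]_x (h x)%:E -> \int[mu]_x (h x `^ p * w x)%:E < +oo ->
  exists T : X -> R,
  [/\ A1_bound (2 * maximal_norm K D p a) T,
      {ae mu, forall x, (h x <= T x)%R} &
      \int[mu]_x (T x `^ p * w x)%:E <=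
        (2 `^ p)%:E * \int[mu]_x (h x `^ p * w x)%:E].
Proof.
move=> p1 wA mh h0 hpos hfin.
have p0 : (0 < p)%R by apply: lt_trans p1.
have w0 x : (0 < w x)%R by exact: (ap_w0 wA).
have mhe : measurable_fun setT (EFin \o h) by exact/measurable_EFinP.
have h0e x : 0 <= (EFin \o h) x by rewrite lee_fin.
have [S [mS hS S1 SI]] := A1_majorant rqm dbl p1 wA mhe h0e.
set L := (2 * _)%R in S1 *.
have L0 : (0 < L)%R by rewrite mulr_gt0// powR_gt0// lt_max ltr01.
have S0 x : 0 <= S x by exact: le_trans (hS x).
(* A zero of [S] at [x] would kill its average on every ball around [x], hence its integral over the
   space, which dominates that of [h]. *)
have Spos x : 0 < S x.
  rewrite lt0e S0 andbT; apply/eqP => Sx; move: hpos; rewrite ltNge => /negP.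
  apply; apply: (@le_trans _ _ (\int[mu]_y S y)).
    apply: ge0_le_integral => // y _; [exact: h0e|exact: hS].
  apply: (@integral_qball_le x) => // n.
  have n0 : (0 < n.+1%:R :> R)%R by rewrite ltr0n.
  have := S1 x _ x n0 (qball_center (rqm_qm rqm) _ n0).
  by rewrite Sx mule0 (avg_le rqm dbl)// mul0e.
have mSp : measurable_fun setT (fun x => S x `^ p * (w x)%:E).
  apply: emeasurable_funM; last exact/measurable_EFinP/(ap_mw wA).
  exact: (measurableT_comp (measurable_poweR _)).
have Sfin : {ae mu, forall x, S x \is a fin_num}.
  have : mu.-integrable setT (fun x => S x `^ p * (w x)%:E).
    apply/integrableP; split=> //.
    under eq_integral => x _ do
      rewrite gee0_abs ?mule_ge0 ?poweR_ge0 ?lee_fin ?(ltW (w0 x))//.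
    by apply: le_lt_trans SI _; rewrite lte_mul_pinfty ?lee_fin ?powR_ge0.
  move=> /(integrable_ae measurableT); apply: filterS => x /(_ I).
  have Sw0 : 0 <= S x `^ p * (w x)%:E.
    by rewrite mule_ge0 ?poweR_ge0 ?lee_fin ?(ltW (w0 x)).
  rewrite !ge0_fin_numE//.
  rewrite !ltey; apply: contra => /eqP ->.
  by rewrite poweRyr ?(gt_eqF p0)// gt0_mulye ?lte_fin.
(* The value 1 on the null set where [S] is infinite keeps [T] positive everywhere. *)
pose T x := if S x \is a fin_num then fine (S x) else 1%R.
have T0 x : (0 < T x)%R.
  rewrite /T; case: ifP => // Sx; rewrite fine_gt0// Spos/= ltey_eq Sx//.
have mT : measurable_fun setT T.
  apply: measurable_fun_ifT => //.
    apply: (measurable_fun_bool true) => /=.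
    by have := emeasurable_fin_num measurableT mS; rewrite setTI.
  exact: (measurableT_comp (fine_measurable measurableT)).
have ST : {ae mu, forall x, S x = (T x)%:E}.
  by apply: filterS Sfin => x Sx; rewrite /T Sx fineK.
have mTe : measurable_fun setT (EFin \o T) by exact/measurable_EFinP.
exists T; split; last 2 first.
- by apply: filterS ST => x Sx; rewrite -lee_fin -Sx; exact: hS.
- apply: le_trans SI; rewrite le_eqVlt; apply/orP; left; apply/eqP.
  apply: ge0_ae_eq_integral => //.
  + apply/measurable_EFinP; apply: measurable_funM; last exact: ap_mw wA.
    exact: (measurableT_comp (measurable_powR _)).
  + by move=> x _; rewrite lee_fin mulr_ge0 ?powR_ge0// ltW.
  + by move=> x _; rewrite mule_ge0 ?poweR_ge0// lee_fin ltW.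
  + by apply: filterS ST => x -> _.
split=> // c r r0.
have SB : avg mu (qball rho c r) S = avg mu (qball rho c r) (EFin \o T).
  congr (_ * _); apply: ge0_ae_eq_integral => //.
  - exact: measurable_funTS.
  - exact: measurable_funTS.
  - by move=> x _; rewrite lee_fin ltW.
  - by apply: filterS ST => x -> _.
have Tavg : {ae mu, forall x, qball rho c r x ->
    avg mu (qball rho c r) (EFin \o T) <= (L * T x)%:E}.
  by apply: filterS ST => x Sx cx; rewrite -SB EFinM -Sx; exact: S1.
(* One point of the ball where the bound holds shows that the average is finite, as [T] is real
   there. *)
have [x cx /(_ cx) le_avg_x] := ae_exists_in Tavg (mball c r)
  (dbl_gt0 dbl c r0).
have Apos : 0 < avg mu (qball rho c r) (EFin \o T).
  rewrite (avgE rqm dbl)// mule_gt0//.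
    by rewrite lte_fin invr_gt0 fine_gt0// (dbl_gt0 dbl)// (dbl_lty dbl).
  by apply: integral_pos_gt0 => //; exact: (dbl_gt0 dbl).
move: Apos le_avg_x Tavg; case: (avg _ _ (EFin \o T)) => [A| |]//.
rewrite lte_fin => A0 _ Tavg; exists A; split=> //.
Qed.

(** On a ball with averages [A] of [H] and [A'] of [V], almost everywhere [H >= A/L1] and
    [V >= A'/L2]. This bounds [H^(1-q)] in the weight and [V^(-1/(q-1))] in its dual
    [H V^(-1/(q-1))]; what remains averages to [A'] and [A], and all averages cancel. *)
Lemma A1_product_Ap (q L1 L2 : R) (H V : X -> R) : (1 < q)%R ->
  (0 < L1)%R -> (0 < L2)%R -> A1_bound L1 H -> A1_bound L2 V ->
  Ap_const mu rho q (fun x => H x `^ (1 - q) * V x)%R <=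
  (L1 `^ (q - 1) * L2)%:E.
Proof.
move=> q1 L10 L20 HA VA; set v := (fun x => _).
have H0 := a1_gt0 HA; have V0 := a1_gt0 VA.
have q0 : (0 < q - 1)%R by rewrite subr_gt0.
have mH := a1_measurable HA; have mV := a1_measurable VA.
have v0 x : (0 < v x)%R by rewrite mulr_gt0 ?powR_gt0.
have mpow (f : X -> R) e : measurable_fun setT f ->
    measurable_fun setT (fun x => f x `^ e)%R.
  by move=> mf; exact: (measurableT_comp (measurable_powR _)).
have dualE x : dual_weight q v x = (H x * V x `^ (- (q - 1)^-1))%:E.
  rewrite /dual_weight inver gt_eqF// poweR_EFin; congr (_%:E).
  rewrite -(powR_inv1 (ltW (v0 x))) -powRrM mulN1r.
  rewrite powRM ?powR_ge0 ?(ltW (V0 x))// -powRrM.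
  rewrite (_ : (1 - q) * - (q - 1)^-1 = 1)%R ?powRr1 ?(ltW (H0 x))//.
  by field; rewrite gt_eqF.
apply: ge_ereal_sup => _ [c [r [r0 ->]]].
have [A [A0 AE Ale]] := a1_le HA c r0.
have [A' [A'0 A'E A'le]] := a1_le VA c r0.
set B := qball rho c r in AE A'E Ale A'le *.
have m0 : (0 < (fine (mu B))^-1)%R.
  by rewrite invr_gt0 fine_gt0// (dbl_gt0 dbl)// (dbl_lty dbl).
have avg_scale (f g : X -> R) (k : R) : measurable_fun setT f ->
    measurable_fun setT g -> (forall x, 0 <= f x)%R -> (forall x, 0 <= g x)%R ->
    (0 <= k)%R -> {ae mu, forall x, B x -> (f x <= k * g x)%R} ->
    avg mu B (EFin \o f) <= k%:E * avg mu B (EFin \o g).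
  move=> mf mg f0 g0 k0 fg; rewrite !(avgE rqm dbl)// muleCA.
  rewrite lee_pmul2l ?lte_fin//.
  rewrite -ge0_integralZl ?lee_fin//; last 2 first.
  - by apply: measurable_funTS; exact/measurable_EFinP.
  - by move=> x _; rewrite lee_fin.
  apply: ae_ge0_le_integral => //.
  - by move=> x _; rewrite lee_fin.
  - by apply: measurable_funTS; exact/measurable_EFinP.
  - by move=> x _; rewrite mule_ge0 ?lee_fin.
  - by apply: measurable_funTS; apply: measurable_funeM; exact/measurable_EFinP.
have av : avg mu B (EFin \o v) <= ((A / L1) `^ (1 - q) * A')%:E.
  rewrite EFinM -A'E; apply: avg_scale => //.
  - by apply: measurable_funM => //; exact: mpow.
  - by move=> x; exact: ltW.
  - by move=> x; exact: ltW.
  - exact: powR_ge0.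
  apply: filterS Ale => x Alex Bx; rewrite ler_wpM2r ?(ltW (V0 x))//.
  rewrite -opprB !powRN lef_pV2 ?posrE ?powR_gt0 ?divr_gt0//.
  rewrite ge0_ler_powR ?nnegrE ?(ltW q0) ?divr_ge0 ?(ltW A0) ?(ltW L10)
    ?(ltW (H0 x))//.
  by rewrite ler_pdivrMr// mulrC Alex.
have adual : avg mu B (dual_weight q v) <=
    ((A' / L2) `^ (- (q - 1)^-1) * A)%:E.
  rewrite EFinM -AE (_ : dual_weight q v =
    EFin \o (fun x => H x * V x `^ (- (q - 1)^-1))%R); last first.
    by apply/funext => x; rewrite dualE.
  apply: avg_scale => //.
  - by apply: measurable_funM => //; exact: mpow.
  - by move=> x; rewrite mulr_ge0 ?powR_ge0// ltW.
  - by move=> x; exact: ltW.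
  - exact: powR_ge0.
  apply: filterS A'le => x A'lex Bx; rewrite mulrC ler_wpM2r ?(ltW (H0 x))//.
  rewrite !powRN lef_pV2 ?posrE ?powR_gt0 ?divr_gt0//.
  rewrite ge0_ler_powR ?nnegrE ?invr_ge0 ?(ltW q0) ?divr_ge0 ?(ltW A'0)
    ?(ltW L20) ?(ltW (V0 x))//.
  by rewrite ler_pdivrMr// mulrC A'lex.
have dual0 : 0 <= avg mu B (dual_weight q v).
  rewrite (avgE rqm dbl)// mule_ge0 ?lee_fin ?(ltW m0)//.
  by apply: integral_ge0 => x _; exact: poweR_ge0.
have {}adual := lee_poweR (ltW q0) dual0 adual.
apply: (@le_trans _ _ (((A / L1) `^ (1 - q) * A')%:E *
    (((A' / L2) `^ (- (q - 1)^-1) * A)%:E `^ (q - 1)))).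
  apply: lee_pmul => //; last exact: poweR_ge0.
  rewrite (avgE rqm dbl)// mule_ge0 ?lee_fin ?(ltW m0)//.
  by apply: integral_ge0 => x _; rewrite lee_fin ltW.
rewrite poweR_EFin -EFinM lee_fin le_eqVlt; apply/orP; left; apply/eqP.
have AL : (0 < A / L1)%R by rewrite divr_gt0.
have A'L : (0 < A' / L2)%R by rewrite divr_gt0.
rewrite (@powRM _ ((A' / L2) `^ _)) ?powR_ge0 ?(ltW A0)// -powRrM mulNr mulVf
  ?gt_eqF//.
rewrite powR_inv1 ?(ltW A'L)// -opprB powRN.
have -> : (A `^ (q - 1) = (A / L1) `^ (q - 1) * L1 `^ (q - 1))%R.
  by rewrite -powRM ?(ltW AL) ?(ltW L10)// divfK ?gt_eqF.
by field; rewrite !gt_eqF ?powR_gt0.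
Qed.

End A1_weight.

(** * Extrapolation *)

Section wnorm_lemmas.
Local Open Scope ereal_scope.
Context (R : realType) d (X : measurableType d)
  (mu : {measure set X -> \bar R}).
Implicit Types (p : R) (w f : X -> R).

Lemma measurable_powR_weight p w f : measurable_fun setT w ->
  measurable_fun setT f -> measurable_fun setT (fun x => f x `^ p * w x)%R.
Proof.
move=> mw mf; apply: measurable_funM => //.
exact: (measurableT_comp (measurable_powR _)).
Qed.

Lemma measurable_wnorm p w f : measurable_fun setT w -> measurable_fun setT f ->
  measurable_fun setT (fun x => (`|f x| `^ p * w x)%:E).
Proof.
move=> mw mf; apply/measurable_EFinP; apply: measurable_powR_weight => //.
exact: measurableT_comp.
Qed.

Lemma wnorm_ge0 p w f : 0 <= wnorm mu p w f.
Proof. exact: poweR_ge0. Qed.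

Lemma ae0_wnorm p w f : (0 < p)%R -> measurable_fun setT w ->
  (forall x, 0 < w x)%R -> measurable_fun setT f ->
  {ae mu, forall x, f x = 0%R} -> wnorm mu p w f = 0.
Proof.
move=> p0 mw w0 mf f0; rewrite /wnorm.
rewrite (@ge0_ae_eq_integral _ _ _ mu setT _ (cst 0))//.
- by rewrite integral0 poweR0r// invr_eq0 gt_eqF.
- exact: measurable_wnorm.
- by move=> x _; rewrite lee_fin mulr_ge0 ?powR_ge0// ltW.
- by apply: filterS f0 => x -> _; rewrite normr0 powR0 ?gt_eqF// mul0r.
Qed.

Lemma wnorm_ae0 p w f : (0 < p)%R -> measurable_fun setT w ->
  (forall x, 0 < w x)%R -> measurable_fun setT f ->
  wnorm mu p w f = 0 -> {ae mu, forall x, f x = 0%R}.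
Proof.
move=> p0 mw w0 mf; have h0 x : 0 <= (`|f x| `^ p * w x)%:E.
  by rewrite lee_fin mulr_ge0 ?powR_ge0// ltW.
move=> /(poweR_eq0_eq0 (integral_ge0 mu (fun x _ => h0 x))) f0.
have : \int[mu]_x `|(`|f x| `^ p * w x)%:E| = 0.
  by rewrite -[RHS]f0; apply: eq_integral => x _; rewrite gee0_abs.
move=> /(ae_eq_integral_abs mu measurableT (measurable_wnorm p mw mf)).
apply: filterS => x /(_ I) [] /eqP; rewrite mulf_eq0 (gt_eqF (w0 x)) orbF.
by rewrite powR_eq0 normr_eq0 => /andP[/eqP].
Qed.

End wnorm_lemmas.

Section extrapolation.
Local Open Scope ereal_scope.
Context (R : realType) d (X : measurableType d) (rho : X -> X -> R).
Context (K : R) (rqm : regular_quasi_metric rho K).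
Context (mu : {measure set X -> \bar R}) (D : R) (dbl : doubling rho mu D).
Context (p0 p a : R) (p01 : (1 < p0)%R) (p1 : (1 < p)%R).
Local Notation p' := (p / (p - 1))%R.

(** The constant of [A1_product_Ap] for majorants in [L^p(w)] and [L^p'(s)]. The maximum with 1 also
    admits the constant weight, on which degenerate cases are tested. *)
Definition extrapolation_const : R := Num.max 1%R
  ((2 * maximal_norm K D p a) `^ (p0 - 1) *
   (2 * maximal_norm K D p' (a `^ (p - 1)^-1)))%R.

Context (w s : X -> R) (wA : Ap_pair rho mu p a w s).

Let mball x r : measurable (qball rho x r).
Proof. exact: rqm_measurable rqm _ _. Qed.
Hint Resolve mball : core.

Let p_gt0 : (0 < p)%R. Proof. exact: lt_trans ltr01 p1. Qed.
Let p0_gt0 : (0 < p0)%R. Proof. exact: lt_trans ltr01 p01. Qed.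
Let q_gt0 : (0 < p - 1)%R. Proof. by rewrite subr_gt0. Qed.
Let q0_gt0 : (0 < p0 - 1)%R. Proof. by rewrite subr_gt0. Qed.
Let p'_gt0 : (0 < p')%R. Proof. by rewrite divr_gt0. Qed.
Let mw := ap_mw wA.
Let ms := ap_ms wA.
Let w0 := ap_w0 wA.
Let s0 := ap_s0 wA.
Let wA' := Ap_pair_dual rqm dbl p1 wA.

Let conj_p : (p^-1 + p'^-1 = 1)%R.
Proof. by rewrite invf_div; field; rewrite gt_eqF. Qed.

Let conj_p0 : (p0^-1 + (p0 / (p0 - 1))^-1 = 1)%R.
Proof. by rewrite invf_div; field; rewrite gt_eqF. Qed.

Let mpow (h : X -> R) r : measurable_fun setT h ->
  measurable_fun setT (fun x => h x `^ r)%R.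
Proof. by move=> mh; exact: (measurableT_comp (measurable_powR _)). Qed.

Let w_s x : (w x `^ (- p^-1) `^ p' = s x)%R.
Proof.
rewrite (ap_sE wA) -powRrM; congr (_ `^ _)%R; field.
by rewrite !gt_eqF.
Qed.

Let mul_pow_root (x y : \bar R) : 0 <= x -> 0 <= y ->
  ((2 `^ p)%:E * x) `^ p^-1 * ((2 `^ p')%:E * y) `^ p'^-1 <=
  4%:E * (x `^ p^-1 * y `^ p'^-1).
Proof.
move=> x0 y0; rewrite !poweRM ?lee_fin ?powR_ge0// !poweR_EFin -!powRrM.
rewrite !mulfV ?gt_eqF// !powRr1// muleACA -EFinM.
by rewrite lee_wpmul2r ?mule_ge0 ?poweR_ge0// lee_fin -natrM.
Qed.

Section with_functions.
Context (f g : X -> R) (N0 : R).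
Context (mf : measurable_fun setT f) (mg : measurable_fun setT g).
Hypothesis N00 : (0 <= N0)%R.
Hypothesis fgN : forall w0, Ap_weight mu rho p0 w0 ->
  Ap_const mu rho p0 w0 <= extrapolation_const%:E ->
  wnorm mu p0 w0 f <= N0%:E * wnorm mu p0 w0 g.

Let G := \int[mu]_x (`|g x| `^ p * w x)%:E.
Hypotheses (gpos : 0 < \int[mu]_x (`|g x|)%:E) (Gfin : G < +oo).

Let mabs (h : X -> R) : measurable_fun setT h ->
  measurable_fun setT (fun x => `|h x|%R).
Proof. by move=> mh; exact: measurableT_comp. Qed.

Lemma extrapolation_truncated (u : X -> R) : measurable_fun setT u ->
  (forall x, 0 <= u x <= `|f x|)%R ->
  \int[mu]_x (u x `^ p * w x)%:E < +oo ->
  \int[mu]_x (u x `^ p * w x)%:E <= ((4 * N0) `^ p)%:E * G.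
Proof.
move=> mu_ uf Ffin; have u0 x : (0 <= u x)%R by case/andP: (uf x).
set F := \int[mu]_x _ in Ffin *.
have F0 : 0 <= F.
  by apply: integral_ge0 => x _; rewrite lee_fin mulr_ge0 ?powR_ge0// ltW.
have G0 : 0 <= G.
  by apply: integral_ge0 => x _; rewrite lee_fin mulr_ge0 ?powR_ge0// ltW.
have [F00|FN0] := eqVneq F 0.
  by rewrite F00 mule_ge0// lee_fin powR_ge0.
have Fpos : 0 < F by rewrite lt0e FN0; exact: F0.
have [H [HA gH HI]] := A1_weight rqm dbl p1 wA (mabs mg) (fun=> normr_ge0 _)
  gpos Gfin.
(* The extremal function of the duality: [k^p' s = u^p w] and [u k = u^p w]. *)
pose k x := (u x `^ (p - 1) * w x)%R.
have mk : measurable_fun setT k by apply: measurable_funM => //; exact: mpow.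
have k0 x : (0 <= k x)%R by rewrite mulr_ge0 ?powR_ge0// ltW.
have kE : \int[mu]_x (k x `^ p' * s x)%:E = F.
  apply: eq_integral => x _; congr (_%:E); rewrite /k powRM ?powR_ge0
    ?(ltW (w0 x))//.
  rewrite -powRrM (_ : (p - 1) * p' = p)%R; last by field; rewrite gt_eqF.
  rewrite -mulrA; congr (_ * _)%R; rewrite (ap_sE wA) -powRD; last first.
    by rewrite (gt_eqF (w0 x)) implybT.
  rewrite (_ : p' + - (p - 1)^-1 = 1)%R ?powRr1 ?(ltW (w0 x))//.
  by field; rewrite gt_eqF.
(* A majorant is only available for a nonzero function; [k = 0] almost everywhere would give
   [u^p w = u k = 0] and [F = 0]. *)
have kpos : 0 < \int[mu]_x (k x)%:E.
  rewrite lt0e integral_ge0 ?andbT; last by move=> x _; rewrite lee_fin.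
  apply/eqP => k00; move/eqP: FN0; apply.
  have : \int[mu]_x `|(k x)%:E| = 0.
    by rewrite -[RHS]k00; apply: eq_integral => x _; rewrite gee0_abs// lee_fin.
  have mke : measurable_fun setT (fun x => (k x)%:E) by exact/measurable_EFinP.
  move=> /(ae_eq_integral_abs mu measurableT mke) kae.
  rewrite /F -(integral0 mu setT); apply: ge0_ae_eq_integral => //.
  - by apply/measurable_EFinP; exact: measurable_powR_weight.
  - by move=> x _; rewrite lee_fin mulr_ge0 ?powR_ge0// ltW.
  apply: filterS kae => x /(_ I) [kx] _.
  by rewrite -(mulr_powRB1 (u0 x) p_gt0) -mulrA -/(k x) kx mulr0.
have [V [VA kV VI]] := A1_weight rqm dbl (dual_gt1 p1) wA' mk k0 kpos
  (eq_ind_r (fun z => z < +oo) Ffin kE).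
rewrite kE in VI.
have H0 := a1_gt0 HA; have V0 := a1_gt0 VA.
have mH := a1_measurable HA; have mV := a1_measurable VA.
set L1 := (2 * _)%R in HA; set L2 := (2 * _)%R in VA.
have L10 : (0 < L1)%R by rewrite mulr_gt0// powR_gt0// lt_max ltr01.
have L20 : (0 < L2)%R by rewrite mulr_gt0// powR_gt0// lt_max ltr01.
pose v x := (H x `^ (1 - p0) * V x)%R.
have v0 x : (0 < v x)%R by rewrite mulr_gt0 ?powR_gt0.
have mv : measurable_fun setT v by apply: measurable_funM => //; exact: mpow.
have vc := A1_product_Ap rqm dbl p01 L10 L20 HA VA.
have vA : Ap_weight mu rho p0 v.
  split=> //; first by move=> x; exact: ltW.
  - exact: aeW.
  - by apply: le_lt_trans vc _; rewrite ltry.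
have {vc}vc : Ap_const mu rho p0 v <= extrapolation_const%:E.
  by apply: le_trans vc _; rewrite lee_fin le_max lexx orbT.
have fgv := fgN vA vc.
pose I := \int[mu]_x (H x * V x)%:E.
have I0 : 0 <= I.
  by apply: integral_ge0 => x _; rewrite lee_fin mulr_ge0// ltW.
have mHV : measurable_fun setT (fun x => (H x * V x)%:E).
  by apply/measurable_EFinP; exact: measurable_funM.
have gI : \int[mu]_x (`|g x| `^ p0 * v x)%:E <= I.
  apply: ae_ge0_le_integral => //.
  - by move=> x _; rewrite lee_fin mulr_ge0 ?powR_ge0// ltW.
  - exact: measurable_wnorm.
  - by move=> x _; rewrite lee_fin mulr_ge0// ltW.
  apply: filterS gH => x gHx _; rewrite lee_fin /v mulrA ler_wpM2r
    ?(ltW (V0 x))//.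
  apply: (@le_trans _ _ (H x `^ p0 * H x `^ (1 - p0))%R).
    by rewrite ler_wpM2r ?powR_ge0// ge0_ler_powR ?nnegrE ?(ltW p0_gt0)
      ?(ltW (H0 x)).
  rewrite -powRD ?(gt_eqF (H0 x)) ?implybT// (_ : p0 + (1 - p0) = 1)%R; last
    by ring.
  by rewrite powRr1// ltW.
have FI : F <= N0%:E * I.
  apply: (@le_trans _ _ (\int[mu]_x (`|f x| * V x)%:E)).
    apply: ae_ge0_le_integral => //.
    - by move=> x _; rewrite lee_fin mulr_ge0 ?powR_ge0// ltW.
    - by apply/measurable_EFinP; exact: measurable_powR_weight.
    - by move=> x _; rewrite lee_fin mulr_ge0// ltW.
    - by apply/measurable_EFinP; apply: measurable_funM => //; exact: mabs.
    apply: filterS kV => x kVx _; rewrite lee_fin.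
    rewrite -(mulr_powRB1 (u0 x) p_gt0) -mulrA -/(k x) ler_pM//.
    by case/andP: (uf x).
  pose e := (p0 / (p0 - 1))%R.
  have e0 : (0 < e)%R by rewrite divr_gt0.
  (* The split [|f| V = (|f| v^(1/p0)) (H V)^(1/e)]: the powers [(1-p0)/p0] and [(p0-1)/p0] of [H]
     cancel, those of [V] add up to 1. *)
  have := @ge0_hoelder _ _ _ mu setT (fun x => `|f x| * v x `^ p0^-1)%R
    (fun x => (H x * V x) `^ e^-1)%R p0 e measurableT.
  have -> : \int[mu]_x (`|f x| * v x `^ p0^-1 * (H x * V x) `^ e^-1)%:E =
      \int[mu]_x (`|f x| * V x)%:E.
    apply: eq_integral => x _; congr (_%:E); rewrite -mulrA; congr (_ * _)%R.
    rewrite /v !powRM ?powR_ge0 ?(ltW (H0 x)) ?(ltW (V0 x))//.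
    rewrite mulrACA -powRrM -!powRD ?(gt_eqF (H0 x)) ?(gt_eqF (V0 x))
      ?implybT//.
    rewrite conj_p0 powRr1 ?(ltW (V0 x))// (_ : _ + _ = 0)%R ?powRr0 ?mul1r//.
    by rewrite /e invf_div; field; rewrite gt_eqF.
  have -> : \int[mu]_x ((`|f x| * v x `^ p0^-1) `^ p0)%:E =
      \int[mu]_x (`|f x| `^ p0 * v x)%:E.
    apply: eq_integral => x _; congr (_%:E); rewrite powRM ?powR_ge0//.
    by rewrite -powRrM mulVf ?gt_eqF// powRr1// ltW.
  have -> : \int[mu]_x (((H x * V x) `^ e^-1) `^ e)%:E = I.
    apply: eq_integral => x _; congr (_%:E).
    by rewrite -powRrM mulVf ?gt_eqF// powRr1// mulr_ge0// ltW.
  move=> /(_ _ _ _ _ p0_gt0 e0 conj_p0) hold.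
  apply: le_trans (hold _ _ _ _) _.
  - by apply: measurable_funM; [exact: mabs|exact: mpow].
  - by apply: mpow; exact: measurable_funM.
  - by move=> x; rewrite mulr_ge0 ?powR_ge0.
  - by move=> x; rewrite powR_ge0.
  apply: (@le_trans _ _ (N0%:E * I `^ p0^-1 * I `^ e^-1)).
    rewrite lee_wpmul2r ?poweR_ge0//; apply: le_trans fgv _.
    rewrite lee_wpmul2l ?lee_fin// lee_poweR ?invr_ge0 ?(ltW p0_gt0)//.
    by apply: integral_ge0 => x _; rewrite lee_fin mulr_ge0 ?powR_ge0// ltW.
  rewrite -muleA -poweRD; last by rewrite add_neq0_poweRD_def// conj_p0
    oner_neq0.
  by rewrite conj_p0 poweRe1.
have IH : I <= 4%:E * (G `^ p^-1 * F `^ p'^-1).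
  (* Inserting [w^(1/p) w^(-1/p) = 1] sends [H] to [L^p(w)] and [V] to [L^p'(s)]. *)
  have := @ge0_hoelder _ _ _ mu setT (fun x => H x * w x `^ p^-1)%R
    (fun x => V x * w x `^ (- p^-1))%R p p' measurableT.
  have -> : \int[mu]_x (H x * w x `^ p^-1 * (V x * w x `^ (- p^-1)))%:E = I.
    apply: eq_integral => x _; congr (_%:E).
    by rewrite mulrACA powRN divff ?mulr1// gt_eqF// powR_gt0.
  have -> : \int[mu]_x ((H x * w x `^ p^-1) `^ p)%:E =
      \int[mu]_x (H x `^ p * w x)%:E.
    apply: eq_integral => x _; congr (_%:E); rewrite powRM ?powR_ge0
      ?(ltW (H0 x))//.
    by rewrite -powRrM mulVf ?gt_eqF// powRr1// ltW.
  have -> : \int[mu]_x ((V x * w x `^ (- p^-1)) `^ p')%:E =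
      \int[mu]_x (V x `^ p' * s x)%:E.
    apply: eq_integral => x _; congr (_%:E); rewrite powRM ?powR_ge0
      ?(ltW (V0 x))//.
    by rewrite w_s.
  move=> /(_ _ _ _ _ p_gt0 p'_gt0 conj_p) hold.
  apply: le_trans (hold _ _ _ _) _.
  - by apply: measurable_funM => //; exact: mpow.
  - by apply: measurable_funM => //; exact: mpow.
  - by move=> x; rewrite mulr_ge0 ?powR_ge0// ltW.
  - by move=> x; rewrite mulr_ge0 ?powR_ge0// ltW.
  apply: (@le_trans _ _ (((2 `^ p)%:E * G) `^ p^-1 * ((2 `^ p')%:E * F) `^
    p'^-1)).
    apply: lee_pmul; [exact: poweR_ge0|exact: poweR_ge0| |].
      by apply: lee_poweR HI; [rewrite invr_ge0 ltW|apply: integral_ge0 => x _;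
        rewrite lee_fin mulr_ge0 ?powR_ge0// ltW].
    by apply: lee_poweR VI; [rewrite invr_ge0 ltW|apply: integral_ge0 => x _;
      rewrite lee_fin mulr_ge0 ?powR_ge0// ltW].
  exact: (mul_pow_root G0 F0).
have {FI IH} : F <= N0%:E * (4%:E * (G `^ p^-1 * F `^ p'^-1)).
  by apply: le_trans FI _; rewrite lee_wpmul2l// lee_fin.
case: (G) G0 Gfin => [Gr| |]// + _; case: (F) Fpos Ffin => [Fr| |]// + _.
rewrite lte_fin lee_fin => Fr0 Gr0; rewrite !poweR_EFin -!EFinM !lee_fin => FrG.
(* The factor [F^(1/p')] occurs on both sides and cancels, [F] being positive and finite. *)
have Fp : (Fr = Fr `^ p^-1 * Fr `^ p'^-1)%R.
  by rewrite -powRD ?conj_p ?powRr1 ?(ltW Fr0)// oner_eq0.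
have : (Fr `^ p^-1 <= 4 * N0 * Gr `^ p^-1)%R.
  rewrite -(@ler_pM2r _ (Fr `^ p'^-1)) ?powR_gt0// -Fp; apply: le_trans FrG _.
  by rewrite le_eqVlt; apply/orP; left; apply/eqP; ring.
have N40 : (0 <= 4 * N0)%R by rewrite mulr_ge0.
move=> /(ge0_ler_powR (ltW p_gt0)); rewrite !nnegrE => /(_ (powR_ge0 _ _)).
move=> /(_ (mulr_ge0 N40 (powR_ge0 _ _))).
by rewrite powRM ?powR_ge0// -!powRrM mulVf ?gt_eqF// !powRr1// ltW.
Qed.

End with_functions.
End extrapolation.

(** * Degenerate cases, truncation and passage to the limit *)

Section extrapolation_pair.
Local Open Scope ereal_scope.
Context (R : realType) d (X : measurableType d) (rho : X -> X -> R).
Context (K : R) (rqm : regular_quasi_metric rho K).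
Context (mu : {measure set X -> \bar R}) (D : R) (dbl : doubling rho mu D).

Let mball x r : measurable (qball rho x r).
Proof. exact: rqm_measurable rqm _ _. Qed.
Hint Resolve mball : core.

Lemma Ap_const_cst1 (q : R) : Ap_const mu rho q (cst 1%R) <= 1.
Proof.
apply: ge_ereal_sup => _ [c [r [r0 ->]]].
have avg1 : avg mu (qball rho c r) (cst 1) = 1.
  rewrite /avg integral_cst// mul1e muleC divee ?(doubling_fin_num rqm dbl)//.
  by rewrite gt_eqF// (dbl_gt0 dbl).
rewrite (_ : dual_weight _ _ = cst 1); last first.
  by apply/funext => x; rewrite /dual_weight/= inve1 poweR1r.
by rewrite (_ : EFin \o cst 1%R = cst 1)// avg1 poweR1r mule1.
Qed.

Lemma Ap_weight_cst1 (q : R) : Ap_weight mu rho q (cst 1%R).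
Proof.
split=> //; first exact: aeW.
by apply: le_lt_trans (Ap_const_cst1 q) _; rewrite ltry.
Qed.

Context (p0 p a : R) (p01 : (1 < p0)%R) (p1 : (1 < p)%R).
Context (w s : X -> R) (wA : Ap_pair rho mu p a w s).

Let p_gt0 : (0 < p)%R. Proof. exact: lt_trans ltr01 p1. Qed.
Let p0_gt0 : (0 < p0)%R. Proof. exact: lt_trans ltr01 p01. Qed.
Let w0 x : (0 < w x)%R. Proof. exact: (ap_w0 wA). Qed.

Section truncation.
Context (f : X -> R) (mf : measurable_fun setT f) (x0 : X).

(** Bounded and supported in a ball, so its [L^p(w)] norm is finite whatever [f] is. The shift to
    [n.+1] keeps the radius positive. *)
Definition truncation n x : R :=
  (Num.min `|f x| n.+1%:R * \1_(qball rho x0 n.+1%:R) x)%R.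

Lemma measurable_truncation n : measurable_fun setT (truncation n).
Proof.
apply: measurable_funM; last exact: measurable_indic.
by apply: measurable_minr => //; exact: measurableT_comp.
Qed.

Lemma truncation_le n x : (0 <= truncation n x <= `|f x|)%R.
Proof.
rewrite /truncation indicE; case: (x \in _); rewrite ?mulr1 ?mulr0 ?lexx//=.
by rewrite le_min normr_ge0 ler0n ge_min lexx.
Qed.

Lemma truncation_nondecreasing n x : (truncation n x <= truncation n.+1 x)%R.
Proof.
rewrite /truncation !indicE; have [xn|xn] := boolP (x \in qball rho x0 n.+1%:R).
  rewrite mem_set; last first.
    by move: xn; rewrite inE; apply: sub_qball; rewrite ler_nat.
  by rewrite !mulr1 le_min ge_min lexx/= ge_min ler_nat leqnSn orbT.
by rewrite mulr0 mulr_ge0// le_min normr_ge0 ler0n.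
Qed.

Lemma truncation_eq x : exists n, truncation n x = `|f x|%R.
Proof.
pose n := maxn (Num.bound `|f x|) (Num.bound (rho x0 x)).
exists n; rewrite /truncation indicE mem_set ?mulr1.
  apply/min_idPl/ltW/(lt_le_trans (archi_boundP (normr_ge0 _))).
  by rewrite ler_nat (leq_trans (leq_maxl _ (Num.bound (rho x0 x)))).
apply: (lt_le_trans (archi_boundP (qm_ge0 (rqm_qm rqm) _ _))).
by rewrite ler_nat (leq_trans (leq_maxr (Num.bound `|f x|) _)).
Qed.

Lemma truncation_lty n :
  \int[mu]_x (truncation n x `^ p * w x)%:E < +oo.
Proof.
have n0 : (0 < n.+1%:R :> R)%R by rewrite ltr0n.
have mw : measurable_fun setT (fun x => (w x)%:E).
  exact/measurable_EFinP/(ap_mw wA).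
apply: (@le_lt_trans _ _ ((n.+1%:R `^ p)%:E *
    \int[mu]_(x in qball rho x0 n.+1%:R) (w x)%:E)); last first.
  rewrite lte_mul_pinfty ?lee_fin ?powR_ge0//.
  exact: (Ap_pair_lty rqm dbl x0 wA n0).
rewrite -ge0_integralZl ?lee_fin ?powR_ge0//; last 2 first.
- exact: measurable_funTS.
- by move=> x _; rewrite lee_fin ltW.
rewrite [leRHS]integral_mkcond; apply: ge0_le_integral => //.
- by move=> x _; rewrite lee_fin mulr_ge0 ?powR_ge0// ltW.
- apply/measurable_EFinP; apply: measurable_powR_weight; first exact: ap_mw wA.
  exact: measurable_truncation.
- apply/(measurable_restrictT _ (mball _ _)); apply: measurable_funTS.
  exact: measurable_funeM.
move=> x _; rewrite patchE /truncation indicE; case: ifP => _.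
  rewrite mulr1 -EFinM lee_fin ler_wpM2r ?(ltW (w0 x))//.
  rewrite ge0_ler_powR ?nnegrE ?(ltW p_gt0) ?le_min ?normr_ge0 ?ler0n//.
  by rewrite ge_min lexx orbT.
by rewrite mulr0 powR0 ?gt_eqF// mul0r.
Qed.

End truncation.

Lemma extrapolates_Ap_pair (f g : X -> R) : measurable_fun setT f ->
  measurable_fun setT g ->
  extrapolates mu rho p0 p (extrapolation_const K D p0 p a) w f g.
Proof.
move=> mf mg N0 fgN.
have mw := ap_mw wA.
(* The constant weight settles the degenerate cases: if [g] vanishes almost everywhere, so does [f];
   otherwise [N0] cannot be negative. *)
have one : wnorm mu p0 (cst 1%R) f <= N0%:E * wnorm mu p0 (cst 1%R) g.
  apply: fgN; first exact: Ap_weight_cst1.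
  by apply: le_trans (Ap_const_cst1 p0) _; rewrite lee_fin le_max lexx.
have m1 : measurable_fun setT (cst 1%R : X -> R) by exact: measurable_cst.
have f0 : wnorm mu p0 (cst 1%R) f <= 0 -> wnorm mu p w f = 0.
  move=> f0; apply: ae0_wnorm => //.
  apply: (@wnorm_ae0 _ _ _ mu p0 (cst 1%R)) => //.
  by apply/eqP; rewrite eq_le f0 wnorm_ge0.
have g0 : {ae mu, forall x, g x = 0%R} ->
    wnorm mu p w f <= (4 * N0)%:E * wnorm mu p w g.
  move=> g0; rewrite f0; first by rewrite (ae0_wnorm p_gt0 mw w0 mg g0) mule0.
  by apply: le_trans one _; rewrite (ae0_wnorm p0_gt0 m1 _ mg g0)// mule0.
have [gz|gN0] := eqVneq (wnorm mu p0 (cst 1%R) g) 0.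
  by apply: g0; apply: (wnorm_ae0 p0_gt0 m1 _ mg gz).
have gpos : 0 < wnorm mu p0 (cst 1%R) g by rewrite lt0e gN0 wnorm_ge0.
have N00 : (0 <= N0)%R.
  rewrite leNgt; apply/negP => N0n.
  have : 0 <= N0%:E * wnorm mu p0 (cst 1%R) g.
    exact: le_trans (wnorm_ge0 _ _ _ _) one.
  by rewrite leNgt; apply/negP/negPn; rewrite nmule_rlt0 ?lte_fin.
(* Since [0 * +oo = 0], an infinite norm of [g] does not make the claim trivial when [N0 = 0]; there
   [f] itself vanishes almost everywhere. *)
have [Nz|NN0] := eqVneq N0 0%R.
  rewrite f0; first by rewrite Nz mulr0 mul0e.
  by apply: le_trans one _; rewrite Nz mul0e.
have Npos : (0 < N0)%R by rewrite lt0r NN0.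
have N4 : (0 < 4 * N0)%R by rewrite mulr_gt0.
have [gy|gfin] := eqVneq (wnorm mu p w g) +oo.
  by rewrite gy gt0_muley ?leey// lte_fin.
have Gfin : \int[mu]_x (`|g x| `^ p * w x)%:E < +oo.
  rewrite ltey; apply: contra gfin => /eqP; rewrite /wnorm => ->.
  by rewrite poweRyr// invr_eq0 gt_eqF.
have G0 : 0 <= \int[mu]_x (`|g x| `^ p * w x)%:E.
  by apply: integral_ge0 => x _; rewrite lee_fin mulr_ge0 ?powR_ge0// ltW.
have gpos1 : 0 < \int[mu]_x (`|g x|)%:E.
  rewrite lt0e integral_ge0// andbT; apply/eqP => gz.
  have mge : measurable_fun setT (EFin \o g) by exact/measurable_EFinP.
  have /(ae_eq_integral_abs mu measurableT mge) gae :
    \int[mu]_x `|(g x)%:E| = 0 by exact: gz.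
  move/eqP: gN0; apply; apply: (ae0_wnorm p0_gt0 m1 _ mg) => //.
  by apply: filterS gae => x /(_ I) [].
have [[x0 _]|noX] := pselect (exists x : X, True); last first.
  by apply: g0; apply: aeW => x; exfalso; apply: noX; exists x.
have bound n : \int[mu]_x (truncation f x0 n x `^ p * w x)%:E <=
    ((4 * N0) `^ p)%:E * \int[mu]_x (`|g x| `^ p * w x)%:E.
  apply: (extrapolation_truncated rqm dbl p01 p1 wA mf mg N00 fgN gpos1 Gfin).
  - exact: measurable_truncation.
  - by move=> x; exact: truncation_le.
  - exact: truncation_lty.
have mt n : measurable_fun setT (fun x => (truncation f x0 n x `^ p * w x)%:E).
  apply/measurable_EFinP; apply: measurable_powR_weight => //.
  exact: measurable_truncation.
have t0 n x : 0 <= (truncation f x0 n x `^ p * w x)%:E.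
  by rewrite lee_fin mulr_ge0 ?powR_ge0// ltW.
have tn n x : (truncation f x0 n x `^ p * w x)%:E <=
    (truncation f x0 n.+1 x `^ p * w x)%:E.
  rewrite lee_fin ler_wpM2r ?(ltW (w0 x))//.
  have [/andP[t1 _] /andP[t2 _]] := (truncation_le f x0 n x, truncation_le f
    x0 n.+1 x).
  by rewrite ge0_ler_powR ?nnegrE ?(ltW p_gt0)//; exact:
    truncation_nondecreasing.
rewrite /wnorm -[X in _ <= X * _](_ : ((4 * N0) `^ p)%:E `^ p^-1 = _); last
  first.
  by rewrite poweR_EFin -powRrM mulfV ?gt_eqF// powRr1// ltW.
rewrite -poweRM ?lee_fin ?powR_ge0//; apply: lee_poweR.
- by rewrite invr_ge0 ltW.
- by apply: integral_ge0 => x _; rewrite lee_fin mulr_ge0 ?powR_ge0// ltW.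
apply: le_trans (integral_sup_le mt t0 tn measurableT bound).
apply: ge0_le_integral => //.
- by move=> x _; rewrite lee_fin mulr_ge0 ?powR_ge0// ltW.
- exact: measurable_wnorm.
- exact: measurable_sup mt tn.
move=> x _; have [n <-] := truncation_eq f x0 x.
by apply: ereal_sup_ubound; exists n.
Qed.

End extrapolation_pair.

(** * Reduction of homogeneous spaces and A_p weights to the setting above *)

Section homogeneous_reduction.
Local Open Scope ereal_scope.
Context (R : realType) d (X : measurableType d) (rho : X -> X -> R).
Context (mu : {measure set X -> \bar R}) (K1 K2 : R).
Context (hX : homogeneous_type mu rho K1 K2).

(** [K1] may be less than 1, for instance on a one-point space, whence the maximum. *)
Lemma homogeneous_quasi_metric : regular_quasi_metric rho (Num.max 1%R K1).
Proof.
have [qm ho hm hb _ _ _] := hX; split=> //; last by rewrite le_max lexx.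
have [q0 qs qe qt] := qm; split=> // x y z.
apply: le_trans (qt x y z) _; rewrite ler_wpM2r ?addr_ge0//.
by rewrite le_max lexx orbT.
Qed.

(** Positivity is given for doubled balls, so it is used at half the radius. Finiteness is given for
    [K2 mu(B)] and passes to [mu(B)] because [mu(2B) > 0] forces [K2 > 0]. *)
Lemma homogeneous_doubling : doubling rho mu (Num.max 1%R K2).
Proof.
have dX := ht_doubling hX.
have pos x r : (0 < r)%R -> 0 < mu (qball rho x r).
  move=> r0; have [+ _ _] := dX x (r / 2)%R (divr_gt0 r0 (ltr0Sn R 1)).
  by rewrite mulrC divfK.
split=> //; first by rewrite le_max lexx.
- move=> x r r0; have [m0 m1 m2] := dX x r r0.
  rewrite ltNge leye_eq; apply/negP => /eqP my; move: m1 m2; rewrite my => m1.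
  have K20 : (0 < K2)%R.
    rewrite ltNge; apply/negP => K20; have := lt_le_trans m0 m1.
    by rewrite ltNge => /negP; apply; rewrite mule_le0_ge0 ?lee_fin// leey.
  by rewrite gt0_muley ?lte_fin.
- move=> x r r0; have [_ m1 _] := dX x r r0; apply: (le_trans m1).
  by rewrite lee_wpmul2r// lee_fin le_max lexx orbT.
Qed.

Lemma measurable_dual_weight (p : R) (w : X -> R) : measurable_fun setT w ->
  (forall x, 0 <= w x)%R -> measurable_fun setT (dual_weight p w).
Proof.
move=> mw w0; apply: (measurableT_comp (measurable_poweR _)) => /=.
rewrite (_ : (fun x => _) =
    (fun x => if w x == 0%R then +oo else (w x `^ (-1))%:E)).
  apply: measurable_fun_ifT => //; first exact: measurable_fun_eqr.
  by apply/measurable_EFinP; exact: (measurableT_comp (measurable_powR _)).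
by apply/funext => x; rewrite inver; case: ifP => // _; rewrite powR_inv1.
Qed.

(** Setting [w] to 1 on the null set where it vanishes changes no average of [w] or of its dual
    weight, and makes the dual weight finite everywhere. *)
Lemma Ap_weight_pair (p a : R) (w : X -> R) : (1 < p)%R ->
  Ap_weight mu rho p w -> Ap_const mu rho p w <= a%:E ->
  exists v s : X -> R, Ap_pair rho mu p a v s /\
    {ae mu, forall x, w x = v x}.
Proof.
move=> p1 [w0 mw wpos wfin] wa.
pose v x := if (0 < w x)%R then w x else 1%R.
pose s x := (v x `^ (- (p - 1)^-1))%R.
have mv : measurable_fun setT v.
  by apply: measurable_fun_ifT => //; exact: measurable_fun_ltr.
have ms : measurable_fun setT s by exact:
  (measurableT_comp (measurable_powR _)).
have wv : {ae mu, forall x, w x = v x}.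
  by apply: filterS wpos => x wx; rewrite /v wx.
have v0 x : (0 < v x)%R by rewrite /v; case: ifP.
have mb := rqm_measurable homogeneous_quasi_metric.
exists v, s; split=> //; split=> // x r r0; apply: le_trans wa.
have -> : avg mu (qball rho x r) (EFin \o v) = avg mu (qball rho x r)
  (EFin \o w).
  congr (_ * _); apply: ge0_ae_eq_integral => //.
  - by apply: measurable_funTS; exact/measurable_EFinP.
  - by apply: measurable_funTS; exact/measurable_EFinP.
  - by move=> y _; rewrite lee_fin ltW.
  - by move=> y _; rewrite lee_fin.
  - by apply: filterS wv => y /= -> _.
have -> : avg mu (qball rho x r) (EFin \o s) =
    avg mu (qball rho x r) (dual_weight p w).
  congr (_ * _); apply: ge0_ae_eq_integral => //.
  - by apply: measurable_funTS; exact/measurable_EFinP.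
  - exact/measurable_funTS/measurable_dual_weight.
  - by move=> y _; rewrite lee_fin powR_ge0.
  - by move=> y _; exact: poweR_ge0.
  - apply: filterS wv => y wvy _; rewrite /= /dual_weight wvy inver gt_eqF//.
    rewrite poweR_EFin /s; congr (_%:E).
    by rewrite -(powR_inv1 (ltW (v0 y))) -powRrM mulN1r.
by apply: ereal_sup_ubound; exists x, r.
Qed.

Lemma ae_eq_wnorm (p : R) (w v f : X -> R) : measurable_fun setT w ->
  measurable_fun setT v -> measurable_fun setT f ->
  (forall x, 0 <= w x)%R -> (forall x, 0 <= v x)%R ->
  {ae mu, forall x, w x = v x} -> wnorm mu p w f = wnorm mu p v f.
Proof.
move=> mw mv mf w0 v0 wv; congr (_ `^ _); apply: ge0_ae_eq_integral => //.
- exact: measurable_wnorm.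
- exact: measurable_wnorm.
- by move=> x _; rewrite lee_fin mulr_ge0 ?powR_ge0.
- by move=> x _; rewrite lee_fin mulr_ge0 ?powR_ge0.
- by apply: filterS wv => x -> _.
Qed.

End homogeneous_reduction.

Theorem theorem2p5 (R : realType) (K1 K2 p0 p : R) :
  1 < p0 -> 1 < p ->
  (forall a : R, exists Lambda0 : R, 1 <= Lambda0 /\
     forall (d : measure_display) (X : measurableType d)
       (mu : {measure set X -> \bar R}) (rho : X -> X -> R),
     homogeneous_type mu rho K1 K2 ->
     forall f g w : X -> R,
     measurable_fun setT f -> measurable_fun setT g ->
     Ap_weight mu rho p w -> Ap_const mu rho p w = a%:E ->
     extrapolates mu rho p0 p Lambda0 w f g) /\
  (forall K0 : R, exists Lambda0 : R, 1 <= Lambda0 /\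
     forall (d : measure_display) (X : measurableType d)
       (mu : {measure set X -> \bar R}) (rho : X -> X -> R),
     homogeneous_type mu rho K1 K2 ->
     forall f g w : X -> R,
     measurable_fun setT f -> measurable_fun setT g ->
     Ap_weight mu rho p w -> (Ap_const mu rho p w <= K0%:E)%E ->
     extrapolates mu rho p0 p Lambda0 w f g).
Proof.
move=> p01 p1.
(* A bound [K0] on the [A_p] constant is all that the construction uses; the first half is the case
   [K0 = a]. *)
suff H (K0 : R) : exists Lambda0 : R, 1 <= Lambda0 /\
     forall (d : measure_display) (X : measurableType d)
       (mu : {measure set X -> \bar R}) (rho : X -> X -> R),
     homogeneous_type mu rho K1 K2 ->
     forall f g w : X -> R,
     measurable_fun setT f -> measurable_fun setT g ->
     Ap_weight mu rho p w -> (Ap_const mu rho p w <= K0%:E)%E ->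
     extrapolates mu rho p0 p Lambda0 w f g.
  split=> // a; have [L [L1 LP]] := H a; exists L; split=> //.
  move=> d X mu rho hX f g w mf mg wA wa; apply: LP => //.
  by rewrite wa.
exists (extrapolation_const (Num.max 1 K1) (Num.max 1 K2) p0 p K0).
split; first by rewrite le_max lexx.
move=> d X mu rho hX f g w mf mg wA wK.
have [v [s [vA wv]]] := Ap_weight_pair hX p1 wA wK.
have [w0 mw _ _] := wA.
have v0 x : 0 <= v x by exact/ltW/(ap_w0 vA).
move=> N0 fgN.
rewrite !(ae_eq_wnorm p mw (ap_mw vA) _ w0 v0 wv)//.
exact: (extrapolates_Ap_pair (homogeneous_quasi_metric hX)
  (homogeneous_doubling hX) p01 p1 vA mf mg fgN).
Qed.
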